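(* Let $X$ and $Y$ be one-sided shift spaces and let $h\colon X\to Y$ be a homeomorphism. The following are equivalent: (i) the map $h\colon X\to Y$ is a one-sided conjugacy; (ii) there is a conjugacy $\tilde h\colon\widetilde X\to\widetilde Y$ satisfying $h\circ\pi_X=\pi_Y\circ\tilde h$; (iii) there is a groupoid isomorphism $\Psi\colon\mathcal G_X\to\mathcal G_Y$ satisfying $h\circ\pi_X=\pi_Y\circ\Psi^{(0)}$, $c_X=c_Y\circ\Psi$ and $\Psi\circ\epsilon_X=\epsilon_Y\circ\Psi$; (iv) there is a groupoid isomorphism $\Psi\colon\mathcal G_X\to\mathcal G_Y$ satisfying $h\circ\pi_X=\pi_Y\circ\Psi^{(0)}$ and $\Psi\circ\epsilon_X=\epsilon_Y\circ\Psi$; (v) there is a $^*$-isomorphism $\Phi\colon\mathcal O_X\to\mathcal O_Y$ satisfying $\Phi(C(X))=C(Y)$ with $\Phi(g)=g\circ h^{-1}$ for $g\in C(X)$, $\Phi\circ p_X=p_Y\circ\Phi$, $\Phi\circ\gamma^X_z=\gamma^Y_z\circ\Phi$ for $z\in\mathbb T$, $\Phi\circ\phi_X|_{\mathcal D_X}=\phi_Y\circ\Phi|_{\mathcal D_X}$, and $\Phi\circ\tau_X=\tau_Y\circ\Phi$; (vi) there is a $^*$-isomorphism $\Phi\colon\mathcal O_X\to\mathcal O_Y$ satisfying $\Phi(C(X))=C(Y)$ with $\Phi(g)=g\circ h^{-1}$ for $g\in C(X)$, and $\Phi\circ\tau_X=\tau_Y\circ\Phi$; (vii) there is a $^*$-isomorphism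 $\Omega\colon\mathcal D_X\to\mathcal D_Y$ satisfying $\Omega(C(X))=C(Y)$, $\Omega(g)=g\circ h^{-1}$ for $g\in C(X)$ and $\Omega\circ\phi_X|_{\mathcal D_X}=\phi_Y\circ\Omega$.
   Context: **Shift spaces.** $\mathbb N=\{0,1,2,\dots\}$. A one-sided shift space is a closed subset $X\subseteq\mathfrak A^{\mathbb N}$ ($\mathfrak A$ a finite discrete alphabet, product topology) with $\sigma(X)\subseteq X$ (equality not assumed), where $\sigma(x)_n=x_{n+1}$; put $\sigma_X=\sigma|_X$. Write $x_{[i,j)}=x_i\cdots x_{j-1}$, and let $P_l(x)$ be the set of words $\mu$ of length $l$ over $\mathfrak A$ with $\mu x\in X$. A homeomorphism $h\colon X\to Y$ is a (one-sided) conjugacy if $h\circ\sigma_X=\sigma_Y\circ h$; likewise a conjugacy $\tilde h\colon\widetilde X\to\widetilde Y$ is a homeomorphism with $\tilde h\circ\sigma_{\widetilde X}=\sigma_{\widetilde Y}\circ\tilde h$. **Cover.** Let $\mathcal I=\{(k,l)\in\mathbb N\times\mathbb N: k\le l\}$ with $(k_1,l_1)\preceq(k_2,l_2)$ iff $k_1\le k_2$ and $l_1-k_1\le l_2-k_2$. For $(k,l)\in\mathcal I$ let $x\overset{k,l}{\sim}x'$ iff $x_{[0,k)}=x'_{[0,k)}$ and $\bigcup_{l'\le l}P_{l'}(\sigma_X^k(x))=\bigcup_{l'\le l}P_{l'}(\sigma_X^k(x'))$; let ${}_k[x]_l$ be the class of $x$ and ${}_kX_l$ the (finite, discrete) set of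 classes. If $(k_1,l_1)\preceq(k_2,l_2)$ then ${}_{k_2}[x]_{l_2}\mapsto{}_{k_1}[x]_{l_1}$ is well defined, and the cover $\widetilde X$ is the projective limit of the ${}_kX_l$ along these maps, a compact Hausdorff space. The map $\sigma_{\widetilde X}\colon\widetilde X\to\widetilde X$ is defined by: the $(k,l)$-coordinate of $\sigma_{\widetilde X}(\tilde x)$ is ${}_k[\sigma_X(y)]_l$ for any representative $y$ of the $(k+1,l+1)$-coordinate of $\tilde x$ (for $k<l$ one may use the $(k+1,l)$-coordinate); it is a local homeomorphism. The factor map $\pi_X\colon\widetilde X\to X$ sends $\tilde x$ to the unique $x\in X$ such that $x_{[0,k)}=y_{[0,k)}$ for every $(k,l)\in\mathcal I$ and every representative $y$ of the $(k,l)$-coordinate of $\tilde x$; it is a continuous surjection and $\sigma_X\circ\pi_X=\pi_X\circ\sigma_{\widetilde X}$. **Groupoid.** $\mathcal G_X=\{(\tilde x,p,\tilde y)\in\widetilde X\times\mathbb Z\times\widetilde X:\exists i,j\in\mathbb N,\ p=i-j,\ \sigma_{\widetilde X}^i(\tilde x)=\sigma_{\widetilde X}^j(\tilde y)\}$ with product $(\tilde x,p,\tilde y)(\tilde y,q,\tilde z)=(\tilde x,p+q,\tilde z)$ and inverse $(\tilde y,-p,\tilde x)$, and topology generated by the sets $\{(\tilde x,i-j,\tilde y):\tilde x\in U,\tilde y\in V,\sigma_{\widetilde X}^i(\tilde x)=\sigma_{\widetilde X}^j(\tilde y)\}$ with $U,V\subseteq\widetilde X$ open, $\sigma^i_{\widetilde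 X}|_U$, $\sigma^j_{\widetilde X}|_V$ injective and $\sigma_{\widetilde X}^i(U)=\sigma_{\widetilde X}^j(V)$. It is a second-countable locally compact Hausdorff étale amenable groupoid with unit space identified with $\widetilde X$. Groupoid isomorphisms are required to be homeomorphisms, and $\Psi^{(0)}\colon\widetilde X\to\widetilde Y$ is the restriction of $\Psi$ to unit spaces. $c_X\colon\mathcal G_X\to\mathbb Z$ is $c_X(\tilde x,p,\tilde y)=p$, and $\epsilon_X\colon\mathcal G_X\to\mathcal G_X$ is $\epsilon_X(\tilde x,p,\tilde y)=(\sigma_{\widetilde X}(\tilde x),p,\sigma_{\widetilde X}(\tilde y))$. **$C^*$-algebras.** $\mathcal O_X=C^*(\mathcal G_X)$ (full = reduced; elements are regarded as $C_0$-functions on $\mathcal G_X$), $\mathcal D_X=C(\widetilde X)\subseteq\mathcal O_X$ (functions on the unit space), and $C(X)$ is regarded as a subalgebra of $\mathcal D_X$ via $f\mapsto f\circ\pi_X$. $p_X\colon\mathcal O_X\to\mathcal D_X$ is the conditional expectation $p_X(g)(\tilde x)=g(\tilde x,0,\tilde x)$. The gauge action $\gamma^X\colon\mathbb T\curvearrowright\mathcal O_X$ is determined by $\gamma^X_z(g)(\tilde x,p,\tilde y)=z^pg(\tilde x,p,\tilde y)$ for $g\in C_c(\mathcal G_X)$. For $a\in\mathfrak A$ let $s_a\in\mathcal O_X$ be the indicator function of the compact open set $\{(\tilde x,1,\sigma_{\widetilde X}(\tilde x)):\pi_X(\tilde x)_0=a\}$ (the canonical generators of $\mathcal O_X$). Define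 $\phi_X,\tau_X\colon\mathcal O_X\to\mathcal O_X$ by $\phi_X(y)=\sum_{a\in\mathfrak A}s_ays_a^*$ and $\tau_X(y)=\sum_{a,b\in\mathfrak A}s_bys_a^*$. *)

(* Defs.v *)
From HB Require Import structures.
From mathcomp Require Import all_boot all_order all_algebra.
From mathcomp Require Import all_classical all_reals all_analysis.
From mathcomp Require Import generic_quotient complex.
From mathcomp Require Import zify ring.
From mathcomp Require summability.

Set Implicit Arguments.
Unset Strict Implicit.
Unset Printing Implicit Defensive.

Import Order.TTheory GRing.Theory Num.Theory numFieldNormedType.Exports.

Local Open Scope classical_set_scope.
Local Open Scope quotient_scope.
Local Open Scope ring_scope.

Record homeo (S T : topologicalType) := Homeo {
  homeo_fun :> S -> T;
  homeo_inv : T -> S;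
  homeo_funK : cancel homeo_fun homeo_inv;
  homeo_invK : cancel homeo_inv homeo_fun;
  homeo_fun_cts : continuous homeo_fun;
  homeo_inv_cts : continuous homeo_inv
}.

Definition full_shift (A : finType) :=
  prod_topology (fun _ : nat => discrete_topology A).

Definition left_shift (A : finType) (x : full_shift A) : full_shift A :=
  fun n => x n.+1.

Record shift_space (A : finType) := ShiftSpace {
  shift_set :> set (full_shift A);
  shift_set_closed : closed shift_set;
  shift_set_stable : forall x, shift_set x -> shift_set (left_shift x)
}.

Definition prepend (A : finType) (mu : seq A) (x : full_shift A) :
  full_shift A :=
  fun n => if (n < size mu)%N then nth (x 0%N) mu n else x (n - size mu)%N.

Section Cover.
Variables (A : finType) (X : shift_space A).
Implicit Types (x y : X).

Definition letter x (n : nat) : A := set_val x n.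

Lemma sigma_subproof x : left_shift (set_val x) \in (X : set _).
Proof. by apply/mem_set/shift_set_stable/set_valP. Qed.

Definition sigma x : X := exist _ (left_shift (set_val x)) (sigma_subproof x).

Definition pred_words (l : nat) x : set (seq A) :=
  [set mu | size mu = l /\ shift_set X (prepend mu (set_val x))].

Definition pred_words_upto (l : nat) x : set (seq A) :=
  \bigcup_(l' in [set l' : nat | (l' <= l)%N]) pred_words l' x.

Definition cidx := {kl : nat * nat | (kl.1 <= kl.2)%N}.
Definition idx_k (i : cidx) : nat := (val i).1.
Definition idx_l (i : cidx) : nat := (val i).2.
Definition cidx_le (i j : cidx) : Prop :=
  (idx_k i <= idx_k j)%N /\ (idx_l i - idx_k i <= idx_l j - idx_k j)%N.

Definition cidx_succ (i : cidx) : cidx :=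
  exist (fun kl : nat * nat => (kl.1 <= kl.2)%N)
    ((idx_k i).+1, (idx_l i).+1) (valP i).

Definition kl_sim (i : cidx) x y : Prop :=
  (forall n, (n < idx_k i)%N -> letter x n = letter y n) /\
  pred_words_upto (idx_l i) (iter (idx_k i) sigma x) =
  pred_words_upto (idx_l i) (iter (idx_k i) sigma y).

Definition kl_simb (i : cidx) : rel X := fun x y => `[< kl_sim i x y >].

Lemma kl_simb_refl i : reflexive (kl_simb i).
Proof. by move=> x; apply/asboolP. Qed.

Lemma kl_simb_sym i : symmetric (kl_simb i).
Proof.
by move=> x y; apply/asboolP/asboolP => -[h1 h2]; split=> // n /h1.
Qed.

Lemma kl_simb_trans i : transitive (kl_simb i).
Proof.
move=> y x z /asboolP[h1 h2] /asboolP[h3 h4]; apply/asboolP; split.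
  by move=> n nk; rewrite h1// h3.
by rewrite h2.
Qed.

Definition kl_equiv (i : cidx) : equiv_rel X :=
  EquivRel (kl_simb i) (kl_simb_refl i) (@kl_simb_sym i) (@kl_simb_trans i).

Definition kl_quot (i : cidx) := {eq_quot kl_equiv i}.

Definition kl_class (i : cidx) x : kl_quot i := \pi_(kl_quot i) x.

Lemma kl_classP i x y : kl_class i x = kl_class i y <-> kl_sim i x y.
Proof.
split; first by move=> /eqmodP /asboolP.
by move=> h; apply/eqmodP/asboolP.
Qed.

Lemma kl_class_repr i (q : kl_quot i) : kl_class i (repr q) = q.
Proof. exact: reprK. Qed.

(* The bonding map $_{k_2}[x]_{l_2} \mapsto {}_{k_1}[x]_{l_1}$; see
   kl_map_class below. *)
Definition kl_map (i j : cidx) (q : kl_quot j) : kl_quot i :=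
  kl_class i (repr q).

Lemma iter_sigmaE n x m : set_val (iter n sigma x) m = letter x (n + m).
Proof.
elim: n m => [|n ih] m //=.
by rewrite addSnnS; exact: (ih m.+1).
Qed.

Lemma pred_words_uptoE l x mu :
  pred_words_upto l x mu <->
  (size mu <= l)%N /\ shift_set X (prepend mu (set_val x)).
Proof.
split; first by move=> [l' /= ll' [-> Xmu]].
by move=> [h1 h2]; exists (size mu).
Qed.

Lemma prepend_iter x k d mu :
  prepend (mu ++ mkseq (fun n => letter x (k + n)) d)
    (set_val (iter (k + d) sigma x)) =
  prepend mu (set_val (iter k sigma x)).
Proof.
apply/funext => n; rewrite /prepend size_cat size_mkseq nth_cat.
rewrite !iter_sigmaE.
case: (ltnP n (size mu)) => nmu.
  by rewrite (leq_trans nmu (leq_addr _ _)); apply: set_nth_default.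
case: ltnP => nd.
  by rewrite nth_mkseq ?iter_sigmaE// ltn_subLR.
by congr (letter x _); rewrite -addnA subnDA subnKC// leq_subRL.
Qed.

Lemma kl_sim_le i j x y : cidx_le i j -> kl_sim j x y -> kl_sim i x y.
Proof.
move=> [hk hl] [hc hw]; split; first by move=> n nk; apply/hc/(leq_trans nk).
have aux (u v : X) : (forall n, (n < idx_k j)%N -> letter u n = letter v n) ->
    pred_words_upto (idx_l j) (iter (idx_k j) sigma u) =
    pred_words_upto (idx_l j) (iter (idx_k j) sigma v) ->
    pred_words_upto (idx_l i) (iter (idx_k i) sigma u) `<=`
    pred_words_upto (idx_l i) (iter (idx_k i) sigma v).
  move=> huv hwuv mu /pred_words_uptoE[smu Xmu]; apply/pred_words_uptoE.
  split=> //.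
  set d := (idx_k j - idx_k i)%N.
  have kd : idx_k j = (idx_k i + d)%N by rewrite subnKC.
  rewrite -(prepend_iter _ _ d).
  have -> : mkseq (fun n => letter v (idx_k i + n)) d =
            mkseq (fun n => letter u (idx_k i + n)) d.
    apply/eq_in_map => n; rewrite mem_iota add0n => /andP[_ nd].
    by rewrite huv// kd ltn_add2l.
  rewrite -kd.
  have : pred_words_upto (idx_l j) (iter (idx_k j) sigma u)
      (mu ++ mkseq (fun n => letter u (idx_k i + n)) d).
    apply/pred_words_uptoE; rewrite kd prepend_iter; split=> //.
    rewrite size_cat size_mkseq.
    have := valP i; have := valP j; rewrite -/(idx_k i) -/(idx_l i).
    rewrite -/(idx_k j) -/(idx_l j) /d; lia.
  by rewrite hwuv => /pred_words_uptoE[].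
apply/seteqP; split; apply: aux => //.
by move=> n nk; rewrite hc.
Qed.

Lemma kl_map_class i j x :
  cidx_le i j -> kl_map i (kl_class j x) = kl_class i x.
Proof.
by move=> ij; apply/kl_classP/(kl_sim_le ij)/kl_classP; rewrite kl_class_repr.
Qed.

Definition cover_set :
  set (prod_topology (fun i : cidx => discrete_topology (kl_quot i))) :=
  [set t | forall i j, cidx_le i j -> t i = kl_map i (t j : kl_quot j)].

Definition cover_space : Type := set_type cover_set.
HB.instance Definition _ := Topological.copy cover_space (set_type cover_set).

Definition cover_coord (t : cover_space) (i : cidx) : kl_quot i := set_val t i.

Lemma cover_coord_map (t : cover_space) i j :
  cidx_le i j -> cover_coord t i = kl_map i (cover_coord t j).
Proof. by move=> ij; have /set_mem := valP t; apply. Qed.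

Lemma kl_sim_sigma i x y :
  kl_sim (cidx_succ i) x y -> kl_sim i (sigma x) (sigma y).
Proof.
move=> [hc hw]; split; first by move=> n nk; apply: (hc n.+1).
rewrite /= -!iterSr; apply/seteqP; split=> mu /pred_words_uptoE[smu Xmu];
  apply/pred_words_uptoE; split=> //.
- have : pred_words_upto (idx_l i).+1 (iter (idx_k i).+1 sigma x) mu.
    by apply/pred_words_uptoE; split=> //; apply: leqW.
  by rewrite hw => /pred_words_uptoE[].
- have : pred_words_upto (idx_l i).+1 (iter (idx_k i).+1 sigma y) mu.
    by apply/pred_words_uptoE; split=> //; apply: leqW.
  by rewrite -hw => /pred_words_uptoE[].
Qed.

Lemma sigma_cover_subproof (t : cover_space) :
  (fun i => kl_class i (sigma (repr (cover_coord t (cidx_succ i)))))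
    \in cover_set.
Proof.
apply/mem_set => i j ij; rewrite kl_map_class//.
apply/kl_classP/kl_sim_sigma/kl_classP; rewrite kl_class_repr.
by apply: cover_coord_map; case: ij => ik il; split; rewrite ?ltnS// subSS.
Qed.

Definition sigma_cover (t : cover_space) : cover_space :=
  exist (fun u => u \in cover_set) _ (sigma_cover_subproof t).

(* $x$ is $\pi_X(\tilde x)$. *)
Definition is_cover_proj (t : cover_space) x : Prop :=
  forall i y, kl_class i y = cover_coord t i ->
    forall n, (n < idx_k i)%N -> letter x n = letter y n.

Lemma cover_proj_ex (t : cover_space) : exists x, is_cover_proj t x.
Proof.
pose d (n : nat) : cidx :=
  exist (fun kl : nat * nat => (kl.1 <= kl.2)%N) (n, n) (leqnn n).
pose r n : X := repr (cover_coord t (d n)).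
pose z : full_shift A := fun n => letter (r n.+1) n.
have agree i y n : kl_class i y = cover_coord t i -> (n < idx_k i)%N ->
    z n = letter y n.
  move=> yi ni.
  have di : cidx_le (d n.+1) i by split=> //; rewrite /= subnn.
  have : kl_class (d n.+1) (r n.+1) = kl_class (d n.+1) y.
    by rewrite kl_class_repr (cover_coord_map _ di) -yi kl_map_class.
  by move=> /kl_classP[+ _]; apply; exact: ltnSn.
have Xz : shift_set X z.
  have rz : (fun n => set_val (r n) : full_shift A) @ \oo --> z.
    apply/pointwise_cvgP => m.
    suff: (letter (r n) m : discrete_topology A) @[n --> \oo] --> z m by [].
    apply: cvg_near_cst; near=> n.
    apply/esym/(agree (d n)); first exact: kl_class_repr.
    by near: n; exact: nbhs_infty_gt.
  apply: (closed_cvg (shift_set X) _ _ _ rz); first exact: shift_set_closed.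
  by apply: nearW => n; exact: set_valP.
exists (exist _ z (mem_set Xz)) => i y yi n ni; exact: agree yi ni.
Unshelve. all: by end_near. Qed.

Definition cover_proj (t : cover_space) : X := projT1 (cid (cover_proj_ex t)).

Record groupoid := Groupoid {
  grange : cover_space;
  gcocycle : int;
  gsource : cover_space;
  gpd_ex : exists i j : nat, gcocycle = i%:Z - j%:Z /\
    iter i sigma_cover grange = iter j sigma_cover gsource
}.

HB.instance Definition _ := gen_eqMixin groupoid.
HB.instance Definition _ := gen_choiceMixin groupoid.

Definition gpd_basic : set (set groupoid) :=
  [set W | exists (U V : set cover_space) (i j : nat),
    [/\ open U, open V, set_inj U (iter i sigma_cover),
        set_inj V (iter j sigma_cover) &
        iter i sigma_cover @` U = iter j sigma_cover @` V] /\
    W = [set g | [/\ U (grange g), gcocycle g = i%:Z - j%:Z, V (gsource g) &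
        iter i sigma_cover (grange g) = iter j sigma_cover (gsource g)]]].

HB.instance Definition _ := isSubBaseTopological.Build groupoid gpd_basic id.

Definition composable (g h : groupoid) : Prop := gsource g = grange h.

Lemma gmul_subproof (g h : groupoid) (c : composable g h) :
  exists i j : nat, gcocycle g + gcocycle h = i%:Z - j%:Z /\
    iter i sigma_cover (grange g) = iter j sigma_cover (gsource h).
Proof.
have [i [j [-> e1]]] := gpd_ex g; have [i' [j' [-> e2]]] := gpd_ex h.
exists (i' + i)%N, (j + j')%N; split; first by rewrite !PoszD; ring.
rewrite iterD e1 c -iterD addnC iterD e2 -iterD.
by [].
Qed.

Definition gmul (g h : groupoid) (c : composable g h) : groupoid :=
  Groupoid (gmul_subproof c).

Lemma ginv_subproof (g : groupoid) :
  exists i j : nat, - gcocycle g = i%:Z - j%:Z /\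
    iter i sigma_cover (gsource g) = iter j sigma_cover (grange g).
Proof. by have [i [j [-> e]]] := gpd_ex g; exists j, i; rewrite opprB. Qed.

Definition ginv (g : groupoid) : groupoid := Groupoid (ginv_subproof g).

Lemma gunit_subproof (t : cover_space) :
  exists i j : nat, 0 = i%:Z - j%:Z /\
    iter i sigma_cover t = iter j sigma_cover t.
Proof. by exists 0, 0; rewrite subrr. Qed.

Definition gunit (t : cover_space) : groupoid := Groupoid (gunit_subproof t).

Lemma geps_subproof (g : groupoid) :
  exists i j : nat, gcocycle g = i%:Z - j%:Z /\
    iter i sigma_cover (sigma_cover (grange g)) =
    iter j sigma_cover (sigma_cover (gsource g)).
Proof.
have [i [j [-> e]]] := gpd_ex g; exists i, j; split=> //.
by rewrite -!iterSr /= e.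
Qed.

Definition geps (g : groupoid) : groupoid := Groupoid (geps_subproof g).

End Cover.

Arguments cover_proj {A X}.
Arguments sigma_cover {A X}.
Arguments sigma {A X}.
Arguments gunit {A X}.
Arguments geps {A X}.

Section GroupoidMorphism.
Variables (A B : finType) (X : shift_space A) (Y : shift_space B).

Definition gpd_hom (Psi : groupoid X -> groupoid Y) : Prop :=
  forall g h (c : composable g h),
    exists c' : composable (Psi g) (Psi h), Psi (gmul c) = gmul c'.

(* A groupoid homomorphism sends units to units, so the range (or source) of
   $\Psi(\tilde x, 0, \tilde x)$ is the point of $\widetilde Y$ identified with
   it. *)
Definition on_units (Psi : groupoid X -> groupoid Y) (t : cover_space X) :
  cover_space Y :=
  grange (Psi (gunit t)).

End GroupoidMorphism.

Definition gpd_iso (A B : finType) (X : shift_space A) (Y : shift_space B)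
    (Psi : homeo (groupoid X) (groupoid Y)) : Prop :=
  gpd_hom Psi /\ gpd_hom (homeo_inv Psi).

Definition CC (R : realType) : numClosedFieldType := R[i].

Definition cabs (R : realType) (z : CC R) : R := complex.Re (`|z| : R[i]).

Section Algebra.
Variables (R : realType) (A : finType) (X : shift_space A).
Local Notation C := (CC R).
Local Notation G := (groupoid X).
Implicit Types (f g : G -> C).

Definition factorizations (c : G) : set (G * G) :=
  [set ab | exists e : composable ab.1 ab.2, gmul e = c].

Definition gconv f g : G -> C := fun c =>
  summability.sum
    (fun ab : factorizations c => f (set_val ab).1 * g (set_val ab).2).

Definition gstar f : G -> C := fun c => (f (ginv c))^*.

Definition cont_compact_supp : set (G -> C) :=
  [set f | continuous f /\ compact (closure [set c | f c != 0])].

Definition l2norm f : \bar R :=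
  ((\esum_(c in [set: G]) (cabs (f c) ^+ 2)%:E) `^ 2^-1)%E.

(* For $\xi$ in the algebraic span of the point masses of
   $\ell^2(s^{-1}(\tilde x))$, the function gconv f xi is
   $\lambda_{\tilde x}(f)\xi$, where $\lambda_{\tilde x}$ is the regular
   representation at $\tilde x$. *)
Definition fin_supp_over (t : cover_space X) : set (G -> C) :=
  [set xi | finite_set [set c | xi c != 0] /\
            forall c, xi c != 0 -> gsource c = t].

Definition reduced_norm f : \bar R :=
  ereal_sup [set l2norm (gconv f xi) | xi in
    [set xi | (exists t, fin_supp_over t xi) /\ (l2norm xi <= 1)%E]].

(* $\mathcal O_X$ as a space of functions. The groupoid is amenable, so its full
   and reduced C*-algebras coincide, and an element of the latter is determined
   by a $C_0$-function on the groupoid; the functions so obtained are exactly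
   the limits of elements of $C_c(\mathcal G_X)$ in the reduced norm. Such
   functions are square summable on every range and source fibre, so the sums
   in gconv converge absolutely on OX. *)
Definition OX : set (G -> C) :=
  [set f | forall e : R, 0 < e ->
    exists2 g, cont_compact_supp g & (reduced_norm (f \- g)%R < e%:E)%E].

Definition gdiag (d : cover_space X -> C) : G -> C :=
  fun c => if `[< c = gunit (grange c) >] then d (grange c) else 0.

Definition DX : set (G -> C) :=
  [set gdiag d | d in [set d : cover_space X -> C | continuous d]].

Definition incl (u : X -> C) : G -> C := gdiag (u \o cover_proj).

Definition CX : set (G -> C) :=
  [set incl u | u in [set u : X -> C | continuous u]].

Definition cond_exp f : G -> C := gdiag (f \o gunit).

(* The formula determining the gauge action on $C_c(\mathcal G_X)$ extends to
   all of $\mathcal O_X$, as evaluation at a point is norm-continuous. *)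
Definition gauge (z : C) f : G -> C := fun c => z ^ gcocycle c * f c.

Definition gen (a : A) : G -> C := fun c =>
  (`[< [/\ gcocycle c = 1, gsource c = sigma_cover (grange c) &
           letter (cover_proj (grange c)) 0%N = a] >])%:R.

Definition phi f : G -> C := fun c =>
  \sum_(a : A) gconv (gconv (gen a) f) (gstar (gen a)) c.

Definition tau f : G -> C := fun c =>
  \sum_(a : A) \sum_(b : A) gconv (gconv (gen b) f) (gstar (gen a)) c.

End Algebra.

Arguments OX : clear implicits.
Arguments OX R {A} X f.
Arguments DX : clear implicits.
Arguments DX R {A} X f.
Arguments CX : clear implicits.
Arguments CX R {A} X f.

Section StarIso.
Variables (R : realType) (A B : finType).
Variables (X : shift_space A) (Y : shift_space B).

Definition star_iso (S : set (groupoid X -> CC R))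
    (T : set (groupoid Y -> CC R))
    (F : (groupoid X -> CC R) -> groupoid Y -> CC R) : Prop :=
  [/\ set_bij S T F,
      forall (z : CC R) f g, S f -> S g ->
        F (fun c => z * f c + g c) = (fun c => z * F f c + F g c),
      forall f g, S f -> S g -> F (gconv f g) = gconv (F f) (F g) &
      forall f, S f -> F (gstar f) = gstar (F f)].

(* $\Phi(C(X)) = C(Y)$ with $\Phi(g) = g \circ h^{-1}$ for $g \in C(X)$. *)
Definition restricts_to (h : homeo X Y)
    (F : (groupoid X -> CC R) -> groupoid Y -> CC R) : Prop :=
  F @` CX R X = CX R Y /\
  forall u : X -> CC R, continuous u ->
    F (incl u) = incl (u \o homeo_inv h).

End StarIso.

(* Main.v *)
Require Import Defs.
From mathcomp Require Import all_boot all_order all_algebra finmap.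
From mathcomp Require Import all_classical all_reals all_analysis.
From mathcomp Require Import complex zify.
From mathcomp Require summability.

(** Why the seven conditions are equivalent.

    The implications from (i) to the others are functorial. A conjugacy and its
    inverse are sliding block codes, so the first k letters of h(x), and the
    words that may precede sigma^k(h(x)), depend only on the first k + c letters
    of x and on the words that may precede sigma^(k+c)(x), c being the length of
    the code. Hence h maps classes of index (k + c, l + c) to classes of index
    (k, l), and passes to the projective limits [conj_lifts]. A conjugacy ht of
    the covers gives the groupoid isomorphism (x, p, y) |-> (ht x, p, ht y)
    [conj_gpd_iso], and composition with the inverse of that isomorphism carries
    the convolution algebra of X to that of Y [push_star_iso]. The generators s_a
    of the two algebras need not correspond to each other under it; what makes it
    respect tau and phi is that these maps can be described without them:
    s_b f s_a^* is f o epsilon cut down to the arrows from letter a to letter b,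
    so that tau(f) = f o epsilon [tauE], and phi(d) = d o sigma on the diagonal
    [phi_gdiag].

    Three implications lead back to (i). An isomorphism of groupoids that
    intertwines the maps epsilon intertwines the shifts of the unit spaces, and
    this descends along the surjections pi [gpd_iso_conj]. If Omega intertwines
    the maps phi, apply it to phi(u) = u o sigma for u in C(X): since Omega is
    composition with the inverse of h on C(X), h^-1 and sigma commute
    [phi_iso_conj]. If only tau is intertwined, use the identity
    tau(u) = (u o sigma) * tau(1) for u in C(X) [tau_incl_conv]; applying the
    isomorphism to it and evaluating at units again gives
    u o sigma o h^-1 = u o h^-1 o sigma [tau_iso_conj].

    The last argument needs u and tau(1) to lie in the algebra. They are
    continuous functions cut down to the sets of arrows (x, i - j, y) with
    sigma^i(x) = sigma^j(y) for fixed i and j, so one shows that these sets are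
    clopen and compact [glevel_open, glevel_closed, glevel_compact]. This rests
    on the covers being compact Hausdorff [cover_space_compact] with a shift map
    that is a local homeomorphism: it is open [sigma_cover_open] and injective on
    points with a given first letter [sigma_cover_inj]. *)

Set Implicit Arguments.
Unset Strict Implicit.
Unset Printing Implicit Defensive.

Import Order.TTheory GRing.Theory Num.Theory numFieldNormedType.Exports.
Local Open Scope classical_set_scope.
Local Open Scope ring_scope.

#[local] Existing Instance summability.totally_filter.

(** * Subspaces of products of discrete spaces *)

Section SubspacesOfDiscreteProducts.
Variables (I : eqType) (T : I -> choiceType).
Variable S : set (prod_topology (fun i => discrete_topology (T i))).

Lemma coord_open (i : I) (P : set (T i)) :
  open [set s : set_type S | P (set_val s i)].
Proof.
have op : open ((proj i : prod_topology (fun i => discrete_topology (T i)) -> _)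
    @^-1` (P : set (discrete_topology (T i)))).
  apply: open_comp; last exact: discrete_open.
  by move=> x _; exact: proj_continuous.
by exists (proj i @^-1` P).
Qed.

(** Shift spaces and covers are both subspaces of products of discrete spaces;
    this criterion reduces their topology to statements about coordinates. *)
Lemma coordwise_cvg (F : set_system (set_type S)) (t : set_type S) :
  Filter F -> (forall i, F [set s | set_val s i = set_val t i]) -> F --> t.
Proof.
move=> FF h U [_ [[B oB <-] Bt BU]].
have FV : Filter (set_val @ F) by exact: fmap_filter.
have : set_val @ F --> set_val t.
  apply/cvg_sup => i; apply/cvg_image.
    rewrite eqEsubset; split => y //= _; exists (dfwith (set_val t) i y) => //.
    by rewrite dfwithin.
  move=> V nV.
  have Vt : V (set_val t i) by apply: nbhs_singleton nV.
  exists ((fun f => f i) @^-1` V).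
    rewrite /= /nbhs /=; apply: (filterS _ (h i)) => s es; rewrite /preimage /=.
    by have -> : set_val s i = set_val t i := es.
  rewrite eqEsubset; split => [_ [f Vf <-]//|y Vy].
  by exists (dfwith (set_val t) i y); rewrite /= dfwithin.
move=> /(_ B (open_nbhs_nbhs (conj oB Bt))) FB.
have {FB} : F (set_val @^-1` B) by [].
by apply: filterS => s Bs; apply: BU.
Qed.

End SubspacesOfDiscreteProducts.

(** * Shift spaces *)

Section Shift.
Variables (A : finType) (X : shift_space A).
Implicit Types (x y : X).

Lemma letter_ext x y : (forall n, letter x n = letter y n) -> x = y.
Proof. by move=> e; apply: val_inj; apply/funext. Qed.

Lemma letter_iter n x m : letter (iter n sigma x) m = letter x (n + m).
Proof. exact: iter_sigmaE. Qed.

Definition agree (n : nat) x y : Prop :=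
  forall m, (m < n)%N -> letter x m = letter y m.

Lemma nbhs_letter n x : nbhs x [set y : X | letter y n = letter x n].
Proof.
apply: open_nbhs_nbhs; split => //.
exact: (@coord_open _ (fun _ : nat => A) (shift_set X) n [set letter x n]).
Qed.

Lemma nbhs_agree n x : nbhs x [set y : X | agree n y x].
Proof.
elim: n => [|n ih]; first by apply: filterS filterT => y _ m.
apply: filterS (filterI ih (nbhs_letter n x)) => y [/= yn e] m.
by rewrite ltnS leq_eqVlt => /orP[/eqP->//|]; exact: yn.
Qed.

Lemma cvg_letters (F : set_system X) x : Filter F ->
  (forall n, F [set y | letter y n = letter x n]) -> F --> x.
Proof. exact: (@coordwise_cvg _ (fun _ : nat => A)). Qed.

(** The filter generated by the cylinders around x converges to x coordinatewise,
    so it contains every neighbourhood of x. *)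
Lemma nbhs_cylinder x (N : set X) : nbhs x N ->
  exists n, forall y, agree n y x -> N y.
Proof.
pose C n := [set y : X | agree n y x].
have FF : Filter (filter_from [set: nat] C).
  apply: filter_from_filter; first by exists 0%N.
  move=> i j _ _; exists (maxn i j) => // y Cy.
  by split=> m mi; apply: Cy; rewrite leq_max mi ?orbT.
have : filter_from [set: nat] C --> x.
  by apply: cvg_letters => n; exists n.+1 => // y /(_ n (ltnSn n)).
by move=> /[apply] -[n _ CN]; exists n.
Qed.

Lemma continuous_letterwise (T : topologicalType) (f : T -> X) :
  (forall t n, nbhs t [set s | letter (f s) n = letter (f t) n]) ->
  continuous f.
Proof. by move=> h t; apply: cvg_letters; exact: (h t). Qed.

Lemma prepend_pointP (mu : seq A) y :
  shift_set X (prepend mu (set_val y)) <->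
  exists x, (forall m, (m < size mu)%N -> letter x m = nth (letter y 0) mu m) /\
    iter (size mu) sigma x = y.
Proof.
split=> [Xz|[x [xl xy]]].
  exists (exist (fun u => u \in (X : set _)) _ (mem_set Xz)); split.
    move=> m mm.
    have e : prepend mu (set_val y) m = nth (letter y 0) mu m.
      by rewrite /prepend mm.
    exact: e.
  apply: letter_ext => n; rewrite letter_iter.
  have e : prepend mu (set_val y) (size mu + n)%N = letter y n.
    by rewrite /prepend ltnNge leq_addr /= addKn.
  exact: e.
have -> : prepend mu (set_val y) = set_val x.
  apply/funext => n; rewrite /prepend; case: ltnP => nm; first by rewrite -xl.
  rewrite -[set_val y _]/(letter y _) -xy letter_iter.
  by rewrite subnKC.
exact: set_valP.
Qed.

End Shift.

(** * The cover of a shift space *)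

Section Cover.
Variables (A : finType) (X : shift_space A).
Implicit Types (x y : X) (t s : cover_space X) (i j : cidx).

Lemma cidx_le_trans i j k : cidx_le i j -> cidx_le j k -> cidx_le i k.
Proof. by case=> a b [c d]; split; [apply: leq_trans c|apply: leq_trans d]. Qed.

Lemma idx_kl i : (idx_k i <= idx_l i)%N.
Proof. exact: valP i. Qed.

(** The coordinates k and l - k turn the order of the index set into the product
    order of nat * nat. *)
Definition mkidx (k d : nat) : cidx :=
  exist (fun kl : nat * nat => (kl.1 <= kl.2)%N) (k, k + d)%N (leq_addr d k).

Lemma mkidxK i : mkidx (idx_k i) (idx_l i - idx_k i) = i.
Proof.
by apply: val_inj; rewrite /= subnKC ?idx_kl// /idx_k /idx_l -surjective_pairing.
Qed.

Lemma mkidx_le k d k' d' : (k <= k')%N -> (d <= d')%N ->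
  cidx_le (mkidx k d) (mkidx k' d').
Proof. by move=> kk dd; split; rewrite /idx_k /idx_l//= !addKn. Qed.

Lemma cidx_directed i j : exists m, cidx_le i m /\ cidx_le j m.
Proof.
exists (mkidx (maxn (idx_k i) (idx_k j))
  (maxn (idx_l i - idx_k i) (idx_l j - idx_k j))).
split; [rewrite -{1}(mkidxK i)|rewrite -{1}(mkidxK j)];
  by apply: mkidx_le; rewrite leq_max leqnn ?orbT.
Qed.

Lemma cidx_le_succ i : cidx_le i (cidx_succ i).
Proof. by split; rewrite /idx_k /idx_l /= ?leqnSn// subSS. Qed.

Lemma kl_class_le i j x y : cidx_le i j ->
  kl_class j x = kl_class j y -> kl_class i x = kl_class i y.
Proof. by move=> ij /kl_classP /(kl_sim_le ij) /kl_classP. Qed.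

Lemma cover_ext s t : (forall i, cover_coord s i = cover_coord t i) -> s = t.
Proof.
by move=> e; apply: val_inj; apply: functional_extensionality_dep => i; apply: e.
Qed.

Lemma cover_coord_le t i j y : cidx_le i j ->
  cover_coord t j = kl_class j y -> cover_coord t i = kl_class i y.
Proof. by move=> ij e; rewrite (cover_coord_map _ ij) e kl_map_class. Qed.

Lemma cover_coord_rep t i : exists y, cover_coord t i = kl_class i y.
Proof. by exists (repr (cover_coord t i)); rewrite kl_class_repr. Qed.

Lemma cover_coordE s t i j : cidx_le i j ->
  cover_coord s j = cover_coord t j -> cover_coord s i = cover_coord t i.
Proof. by move=> ij e; rewrite !(cover_coord_map _ ij) e. Qed.

Lemma open_cover_coord i (P : set (kl_quot X i)) :
  open [set t : cover_space X | P (cover_coord t i)].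
Proof. exact: (@coord_open _ (kl_quot X) (@cover_set A X) i P). Qed.

Lemma cvg_cover (F : set_system (cover_space X)) t : Filter F ->
  (forall i, F [set s | cover_coord s i = cover_coord t i]) -> F --> t.
Proof. exact: (@coordwise_cvg _ (kl_quot X)). Qed.

(** A single coordinate suffices for a basic neighbourhood because the index set
    is directed. *)
Lemma nbhs_coverP t (N : set (cover_space X)) : nbhs t N <->
  exists i, forall s, cover_coord s i = cover_coord t i -> N s.
Proof.
split; last first.
  move=> [i iN]; apply: (filterS iN); apply: open_nbhs_nbhs; split => //.
  exact: (@open_cover_coord i [set cover_coord t i]).
pose C i := [set s : cover_space X | cover_coord s i = cover_coord t i].
have FF : Filter (filter_from [set: cidx] C).
  apply: filter_from_filter; first by exists (mkidx 0 0).
  move=> i j _ _; have [m [im jm]] := cidx_directed i j.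
  by exists m => // s Cs; split; apply: cover_coordE Cs.
have : filter_from [set: cidx] C --> t by apply: cvg_cover => i; exists i.
by move=> /[apply] -[i _ CN]; exists i.
Qed.

Lemma continuous_coverwise (T : topologicalType) (f : T -> cover_space X) :
  (forall p i, nbhs p [set q | cover_coord (f q) i = cover_coord (f p) i]) ->
  continuous f.
Proof. by move=> h p; apply: cvg_cover; exact: (h p). Qed.

Lemma cover_hausdorff : hausdorff_space (cover_space X).
Proof.
move=> s t cl; apply: cover_ext => i.
have nb (u : cover_space X) :
    nbhs u [set v : cover_space X | cover_coord v i = cover_coord u i].
  by apply/nbhs_coverP; exists i.
by have [v [/= <- <-]] := cl _ _ (nb s) (nb t).
Qed.

Lemma cover_coord_sigma t i y :
  cover_coord t (cidx_succ i) = kl_class (cidx_succ i) y ->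
  cover_coord (sigma_cover t) i = kl_class i (sigma y).
Proof.
by move=> e; apply/kl_classP/kl_sim_sigma/kl_classP; rewrite kl_class_repr.
Qed.

Lemma sigma_cover_continuous : continuous (@sigma_cover A X).
Proof.
apply: continuous_coverwise => t i; apply/nbhs_coverP; exists (cidx_succ i).
move=> s e /=; have [y ye] := cover_coord_rep t (cidx_succ i).
by rewrite (cover_coord_sigma ye) (cover_coord_sigma (y := y)) ?e.
Qed.

Lemma iter_sigma_cover_continuous n : continuous (iter n (@sigma_cover A X)).
Proof.
elim: n => [|n ih] t /=; first exact: cvg_id.
by apply: continuous_comp; [exact: ih|exact: sigma_cover_continuous].
Qed.

Lemma letter_proj t i y n : cover_coord t i = kl_class i y ->
  (n < idx_k i)%N -> letter (cover_proj t) n = letter y n.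
Proof. by move=> e; apply: (projT2 (cid (cover_proj_ex t))). Qed.

Lemma letter_proj_coord s t i n : cover_coord s i = cover_coord t i ->
  (n < idx_k i)%N -> letter (cover_proj s) n = letter (cover_proj t) n.
Proof.
have [y ye] := cover_coord_rep t i => e ni.
by rewrite (letter_proj ye ni) (letter_proj _ ni (y := y))// e.
Qed.

Lemma nbhs_letter_proj t n :
  nbhs t [set s | letter (cover_proj s) n = letter (cover_proj t) n].
Proof.
apply/nbhs_coverP; exists (mkidx n.+1 0) => s e.
exact: letter_proj_coord e _.
Qed.

Lemma cover_proj_continuous : continuous (@cover_proj A X).
Proof. by apply: continuous_letterwise => t n; exact: nbhs_letter_proj. Qed.

Lemma cover_proj_sigma t : cover_proj (sigma_cover t) = sigma (cover_proj t).
Proof.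
apply: letter_ext => n.
have [y ye] := cover_coord_rep t (cidx_succ (mkidx n.+1 0)).
rewrite (letter_proj (cover_coord_sigma ye)) ?ltnSn//.
by rewrite [RHS](letter_proj (n := n.+1) ye).
Qed.

Lemma cover_proj_iter n t :
  cover_proj (iter n sigma_cover t) = iter n sigma (cover_proj t).
Proof. by elim: n => //= n <-; rewrite cover_proj_sigma. Qed.

Lemma cover_of_subproof x : (fun i => kl_class i x) \in @cover_set A X.
Proof. by apply/mem_set => i j ij; rewrite kl_map_class. Qed.

Definition cover_of x : cover_space X :=
  exist (fun u => u \in @cover_set A X) _ (cover_of_subproof x).

Lemma cover_ofK x : cover_proj (cover_of x) = x.
Proof.
by apply: letter_ext => n; apply: (@letter_proj _ (mkidx n.+1 0)).
Qed.

(** Prepending a letter to y uses up one letter of the words that may precede y.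
    To control a class of index (k + 1, l + 1) of the extended point one thus
    needs the class of y of index (k, l + 1), not only (k, l). *)
Definition widen_idx i : cidx := mkidx (idx_k i) (idx_l i - idx_k i).+1.

Lemma widen_idx_le i j : cidx_le i j -> cidx_le (widen_idx i) (widen_idx j).
Proof. by case=> a b; apply: mkidx_le. Qed.

Lemma le_widen_idx i : cidx_le i (widen_idx i).
Proof. by rewrite -{1}(mkidxK i); apply: mkidx_le. Qed.

Lemma kl_class_cons i x y : letter x 0%N = letter y 0%N ->
  kl_class (widen_idx i) (sigma x) = kl_class (widen_idx i) (sigma y) ->
  kl_class (cidx_succ i) x = kl_class (cidx_succ i) y.
Proof.
move=> e0 /kl_classP[el ep]; apply/kl_classP; split.
  by case=> // n; apply: (el n).
move: ep; rewrite /idx_k /idx_l /= -!iterSr -/(idx_k i) -/(idx_l i).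
by rewrite addnS subnKC// idx_kl.
Qed.

(** By [kl_class_cons] the first letter and the coordinates of the shifted point
    at widened indices determine all coordinates of a point of the cover. *)
Lemma sigma_cover_inj s t :
  letter (cover_proj s) 0%N = letter (cover_proj t) 0%N ->
  sigma_cover s = sigma_cover t -> s = t.
Proof.
move=> e0 es; apply: cover_ext => i.
have [x xe] := cover_coord_rep s (cidx_succ (widen_idx i)).
have [y ye] := cover_coord_rep t (cidx_succ (widen_idx i)).
have le : cidx_le i (cidx_succ (widen_idx i)).
  exact: cidx_le_trans (le_widen_idx i) (cidx_le_succ _).
rewrite (cover_coord_le le xe) (cover_coord_le le ye).
apply: (kl_class_le (cidx_le_succ i)); apply: kl_class_cons.
  by rewrite -(letter_proj xe)// -(letter_proj ye).
by rewrite -(cover_coord_sigma xe) -(cover_coord_sigma ye) es.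
Qed.

Lemma iter_sigma_cover_inj n s t :
  agree n (cover_proj s) (cover_proj t) ->
  iter n sigma_cover s = iter n sigma_cover t -> s = t.
Proof.
elim: n => //= n ih el es; apply: ih; first by move=> m /ltnW; apply: el.
apply: sigma_cover_inj es; rewrite !cover_proj_iter !letter_iter addn0.
exact: el.
Qed.

Lemma prepend_letter x :
  prepend [:: letter x 0%N] (set_val (sigma x)) = set_val x.
Proof. by apply/funext => -[|n]//=; rewrite /prepend /= subSS subn0. Qed.

(** Every s close to the image of t is itself an image, of a point close to t.
    Coordinate (0, 1) of s records which letters may precede it; as it agrees
    with that of the image of t, the first letter a of t may precede every
    representative of every coordinate of s. Prepending a to all of them gives a
    coherent family, again by [kl_class_cons]. *)
Lemma sigma_cover_section t i s :
  cover_coord s (widen_idx i) = cover_coord (sigma_cover t) (widen_idx i) ->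
  exists u, sigma_cover u = s /\
    cover_coord u (cidx_succ i) = cover_coord t (cidx_succ i).
Proof.
move=> es; pose a := letter (cover_proj t) 0%N.
pose o := mkidx 0 1.
have os : cover_coord s o = cover_coord (sigma_cover t) o.
  by apply: cover_coordE es; apply: mkidx_le.
have lift (j : cidx) : exists z : X, letter z 0%N = a /\
    cover_coord s (widen_idx j) = kl_class (widen_idx j) (sigma z).
  have [y ye] := cover_coord_rep t (cidx_succ o).
  have [w we] := cover_coord_rep s (widen_idx j).
  have /kl_classP[_ ep] : kl_class o (sigma y) = kl_class o w.
    rewrite -(cover_coord_sigma ye) -os; apply: cover_coord_le we.
    exact: mkidx_le.
  have : pred_words_upto (idx_l o) w [:: a].
    rewrite -[w]/(iter (idx_k o) sigma w) -ep; apply/pred_words_uptoE; split => //.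
    rewrite /a (letter_proj ye)// prepend_letter; exact: set_valP.
  move=> /pred_words_uptoE[_ Xz].
  have [z [zl /= zw]] := (prepend_pointP _ _).1 Xz.
  by exists z; rewrite we zw (zl 0%N).
have [z zP] := choice lift.
have zcoh j j' : cidx_le j j' ->
    kl_class (cidx_succ j) (z j) = kl_class (cidx_succ j) (z j').
  move=> jj; have [a1 s1] := zP j; have [a2 s2] := zP j'.
  apply: kl_class_cons; first by rewrite a1 a2.
  by rewrite -s1; apply: cover_coord_le s2; exact: widen_idx_le.
have uP : (fun j => kl_class j (z j)) \in @cover_set A X.
  apply/mem_set => j j' jj; rewrite kl_map_class//.
  exact: kl_class_le (cidx_le_succ j) (zcoh _ _ jj).
pose u : cover_space X := exist (fun u => u \in @cover_set A X) _ uP.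
exists u; split.
  apply: cover_ext => j.
  rewrite (cover_coord_sigma (y := z (cidx_succ j)))//; symmetry.
  have [_ e] := zP (cidx_succ j); apply: cover_coord_le e.
  exact: cidx_le_trans (cidx_le_succ j) (le_widen_idx _).
have -> : cover_coord u (cidx_succ i) = kl_class (cidx_succ i) (z (cidx_succ i)).
  by [].
rewrite -zcoh; last exact: cidx_le_succ.
have [y ye] := cover_coord_rep t (cidx_succ (widen_idx i)).
rewrite (@cover_coord_le t (cidx_succ i) _ y _ ye); last first.
  by have [? ?] := le_widen_idx i; split; rewrite /idx_k /idx_l /= ?subSS ?ltnS.
have [az sz] := zP i; apply: kl_class_cons.
  by rewrite az /a (letter_proj ye).
by rewrite -sz es (cover_coord_sigma ye).
Qed.

Lemma sigma_cover_open (U : set (cover_space X)) :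
  open U -> open (sigma_cover @` U).
Proof.
move=> oU; rewrite openE => _ [t Ut <-]; apply/nbhs_coverP.
have /nbhs_coverP[i iU] : nbhs t U by exact: open_nbhs_nbhs.
exists (widen_idx i) => s /sigma_cover_section[u [<- ue]].
by exists u => //; apply: iU; apply: cover_coordE ue; exact: cidx_le_succ.
Qed.

Lemma iter_sigma_cover_open n (U : set (cover_space X)) :
  open U -> open (iter n sigma_cover @` U).
Proof.
move=> oU; elim: n => [|n ih]; first by rewrite image_id.
by rewrite /= -[X in open X]image_comp; exact: sigma_cover_open.
Qed.

(** A class is determined by a word of length k and a set of words of length at
    most l over the finite alphabet. *)
Lemma kl_quot_finite i : finite_set [set: kl_quot X i].
Proof.
pose f (q : kl_quot X i) :=
  ([ffun n : 'I_(idx_k i) => letter (repr q) n],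
   [set w : (idx_l i).-bseq A |
      `[< pred_words_upto (idx_l i) (iter (idx_k i) sigma (repr q)) w >]]%SET).
have f_inj : injective f.
  move=> q r e; rewrite -[q]kl_class_repr -[r]kl_class_repr.
  have [/ffunP e1 /setP e2] := (congr1 fst e, congr1 snd e).
  apply/kl_classP; split.
    by move=> n ni; have := e1 (Ordinal ni); rewrite !ffunE.
  have {e2} e2 w : (size w <= idx_l i)%N ->
      pred_words_upto (idx_l i) (iter (idx_k i) sigma (repr q)) w <->
      pred_words_upto (idx_l i) (iter (idx_k i) sigma (repr r)) w.
    move=> sw; have := e2 (Bseq sw); rewrite !inE => /eqP.
    by move=> /eqP e2w; split => /asboolP h; apply/asboolP; rewrite ?e2w// -e2w.
  apply/seteqP; split => w hw; have [sw _] := (pred_words_uptoE _ _ _).1 hw.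
    by apply/e2.
  by apply/e2.
rewrite -(preimage_setT f); apply: finite_preimage; last exact: finite_finset.
by move=> q r _ _; exact: f_inj.
Qed.

(** An ultrafilter on the cover contains exactly one class of each of the finite
    partitions by coordinates. These classes are coherent, as any two of the
    corresponding sets meet, and they form the limit. *)
Lemma cover_space_compact : compact [set: cover_space X].
Proof.
rewrite compact_ultra => F FU _.
have FP : ProperFilter F by exact: ultra_proper.
have co i : exists q, F [set s | cover_coord s i = q].
  have : compact [set: discrete_topology (kl_quot X i)].
    exact/finite_compact/kl_quot_finite.
  move=> /(_ ((fun s : cover_space X => cover_coord s i) @ F)).
  case; first exact: filterT.
  move=> q [_ cl]; exists q.
  have [//|nF] := in_ultra_setVsetC [set s | cover_coord s i = q] FU.
  by have [r [nr /nr]] := cl [set~ q] [set q] nF (discrete_set1 _).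
pose q i := projT1 (cid (co i)).
have qP i : F [set s | cover_coord s i = q i] := projT2 (cid (co i)).
have qc : q \in @cover_set A X.
  apply/mem_set => i j ij.
  have [s [<- <-]] := @filter_ex _ _ FP _ (filterI (qP i) (qP j)).
  exact: cover_coord_map.
exists (exist (fun u => u \in @cover_set A X) q qc); split => //.
by apply: cvg_cover => i; exact: qP.
Qed.

End Cover.

(** * Sliding block codes and lifting a conjugacy to the covers *)

Section BlockCodes.
Variables (A : finType) (X : shift_space A).
Implicit Types (x y : X).

Lemma shift_compact : compact [set: X].
Proof.
have -> : [set: X] = cover_proj @` [set: cover_space X].
  by rewrite eqEsubset; split=> // x _; exists (cover_of x) => //; exact: cover_ofK.
apply: (@continuous_compact (cover_space X) X); last exact: cover_space_compact.
exact/continuous_subspaceT/cover_proj_continuous.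
Qed.

(** Each x has a cylinder on which f is constant, and by compactness one length
    of cylinders serves for all x. *)
Lemma locally_constant_code (T : Type) (f : X -> T) :
  (forall x, nbhs x [set y | f y = f x]) ->
  exists c, forall x y, agree c x y -> f x = f y.
Proof.
move=> lc.
have := (compact_near_coveringP _).1 shift_compact nat \oo%classic
  (fun c x => forall y, agree c x y -> f x = f y) _.
case.
  move=> x _; have [n nP] := nbhs_cylinder (lc x).
  exists ([set y : X | agree n y x], [set c | (n <= c)%N]) => /=.
    by split; [exact: nbhs_agree|exists n].
  move=> [y c] [/= yx nc] z yz; rewrite (nP _ yx); symmetry; apply: nP.
  by move=> m mn; rewrite -(yz m (leq_trans mn nc)); exact: yx.
by move=> c _ cP; exists c => x y; apply: (cP c) => /=.
Qed.

End BlockCodes.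

(** [hc] says that [h] is a sliding block code of length c. *)
Section ConjugacyLifts.
Variables (A B : finType) (X : shift_space A) (Y : shift_space B).
Variables (h : X -> Y) (g : Y -> X) (c : nat).
Hypotheses (hK : cancel h g) (gK : cancel g h).
Hypothesis hs : forall x, h (sigma x) = sigma (h x).
Hypothesis hc : forall x y, agree c x y -> letter (h x) 0%N = letter (h y) 0%N.

Lemma conj_iter n x : h (iter n sigma x) = iter n sigma (h x).
Proof. by elim: n => //= n <-. Qed.

Lemma conj_iter_inv n y : g (iter n sigma y) = iter n sigma (g y).
Proof. by rewrite -{1}(gK y) -conj_iter hK. Qed.

Lemma conj_letter n x y : agree (n + c) x y ->
  letter (h x) n = letter (h y) n.
Proof.
move=> xy; rewrite -[n]addn0 -!letter_iter -!conj_iter; apply: hc => m mc.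
by rewrite !letter_iter; apply: xy; rewrite ltn_add2l.
Qed.

Lemma conj_agree n x y : agree (n + c) x y -> agree n (h x) (h y).
Proof.
move=> xy m mn; apply: conj_letter => p pm; apply: xy.
by apply: leq_trans pm _; rewrite leq_add2r ltnW.
Qed.

Definition shift_idx i := mkidx (idx_k i + c) (idx_l i - idx_k i).

Lemma shift_idx_le i j : cidx_le i j -> cidx_le (shift_idx i) (shift_idx j).
Proof. by case=> a b; apply: mkidx_le; rewrite ?leq_add2r. Qed.

Lemma le_shift_idx i : cidx_le i (shift_idx i).
Proof. by rewrite -{1}(mkidxK i); apply: mkidx_le; rewrite ?leq_addr. Qed.

(** A word mu preceding z' = sigma^k(h x) corresponds to a word nu of the same
    length preceding z = sigma^k(x): pull the point mu z' back by the inverse of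
    h. As x and y have the same preceding words, nu may precede sigma^k(y) too,
    and h maps the resulting point to one beginning with mu, because the letters
    of mu are determined by nu and the first c letters of z. *)
Lemma conj_pred_words i x y : kl_sim (shift_idx i) x y ->
  pred_words_upto (idx_l i) (iter (idx_k i) sigma (h x)) `<=`
  pred_words_upto (idx_l i) (iter (idx_k i) sigma (h y)).
Proof.
move=> sim mu /pred_words_uptoE[smu /prepend_pointP[w [wl wx]]].
apply/pred_words_uptoE; split => //; apply/prepend_pointP.
have [_ ep] := kl_sim_le (le_shift_idx i) sim.
pose nu := mkseq (letter (g w)) (size mu).
have gw : iter (size mu) sigma (g w) = iter (idx_k i) sigma x.
  by rewrite -conj_iter_inv wx -conj_iter hK.
have : pred_words_upto (idx_l i) (iter (idx_k i) sigma x) nu.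
  apply/pred_words_uptoE; rewrite size_mkseq; split => //.
  apply/prepend_pointP; exists (g w); rewrite size_mkseq; split => // m mmu.
  by rewrite nth_mkseq.
rewrite ep => /pred_words_uptoE[_ /prepend_pointP[v []]].
rewrite size_mkseq => vl vy.
exists (h v); split; last by rewrite -conj_iter vy conj_iter.
move=> m mmu; rewrite (set_nth_default (letter (iter (idx_k i) sigma (h x)) 0))//.
rewrite -wl// -[w in RHS]gK; apply: conj_letter => p pm.
case: (ltnP p (size mu)) => pmu; first by rewrite vl// nth_mkseq.
rewrite -(subnKC pmu) -!letter_iter vy gw !letter_iter.
have [ea _] := sim; symmetry; apply: ea.
by rewrite ltn_add2l; move: pm; clear -mmu pmu => pm; lia.
Qed.

Lemma conj_kl_sim i x y : kl_sim (shift_idx i) x y -> kl_sim i (h x) (h y).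
Proof.
move=> sim; split; first by have [ea _] := sim; exact: conj_agree ea.
apply/seteqP; split; apply: conj_pred_words => //.
by case: sim => a b; split=> // n ni; rewrite a.
Qed.

Lemma cover_lift_subproof (t : cover_space X) :
  (fun i => kl_class i (h (repr (cover_coord t (shift_idx i)))))
    \in @cover_set B Y.
Proof.
apply/mem_set => i j ij; rewrite kl_map_class//.
apply/kl_classP/conj_kl_sim/kl_classP; rewrite kl_class_repr.
by rewrite (cover_coord_map _ (shift_idx_le ij)).
Qed.

Definition cover_lift (t : cover_space X) : cover_space Y :=
  exist (fun u => u \in @cover_set B Y) _ (cover_lift_subproof t).

Lemma cover_coord_lift t i x :
  cover_coord t (shift_idx i) = kl_class (shift_idx i) x ->
  cover_coord (cover_lift t) i = kl_class i (h x).
Proof.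
by move=> e; apply/kl_classP/conj_kl_sim/kl_classP; rewrite kl_class_repr.
Qed.

Lemma cover_lift_continuous : continuous cover_lift.
Proof.
apply: continuous_coverwise => t i; apply/nbhs_coverP; exists (shift_idx i).
move=> s e /=; have [y ye] := cover_coord_rep t (shift_idx i).
by rewrite (cover_coord_lift ye) (cover_coord_lift (x := y)) ?e.
Qed.

Lemma cover_proj_lift t : cover_proj (cover_lift t) = h (cover_proj t).
Proof.
apply: letter_ext => n; have [y ye] := cover_coord_rep t (shift_idx (mkidx n.+1 0)).
rewrite (letter_proj (cover_coord_lift ye)) ?ltnSn//.
apply: conj_letter => m mn; rewrite (letter_proj ye)//.
by rewrite /idx_k /= addSn ltnS ltnW.
Qed.

Lemma cover_lift_sigma t : cover_lift (sigma_cover t) = sigma_cover (cover_lift t).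
Proof.
apply: cover_ext => i.
have [y ye] := cover_coord_rep t (cidx_succ (shift_idx i)).
rewrite (cover_coord_lift (cover_coord_sigma ye)) hs.
rewrite (cover_coord_sigma (y := h y))//; apply: cover_coord_lift.
apply: cover_coord_le ye; have := idx_kl i.
by rewrite /cidx_le /idx_k /idx_l /= /idx_k /idx_l /= /idx_k /idx_l /= => ?; split; lia.
Qed.

End ConjugacyLifts.

Lemma homeo_code (A B : finType) (X : shift_space A) (Y : shift_space B)
    (h : homeo X Y) : exists c, forall x y,
  agree c x y -> letter (h x) 0%N = letter (h y) 0%N.
Proof.
apply: (@locally_constant_code _ _ _ (fun x => letter (h x) 0%N)) => x.
exact: (@homeo_fun_cts _ _ h x _ (nbhs_letter 0 (h x))).
Qed.

Definition homeo_sym (S T : topologicalType) (h : homeo S T) : homeo T S :=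
  Homeo (homeo_invK h) (homeo_funK h) (@homeo_inv_cts _ _ h) (@homeo_fun_cts _ _ h).

Lemma cover_liftK (A B : finType) (X : shift_space A) (Y : shift_space B)
  (h : X -> Y) (g : Y -> X) (c d : nat) (hK : cancel h g) (gK : cancel g h)
  (hs : forall x, h (sigma x) = sigma (h x))
  (gs : forall x, g (sigma x) = sigma (g x))
  (hc : forall x y, agree c x y -> letter (h x) 0%N = letter (h y) 0%N)
  (gd : forall x y, agree d x y -> letter (g x) 0%N = letter (g y) 0%N) :
  cancel (cover_lift hK gK hs hc) (cover_lift gK hK gs gd).
Proof.
move=> t; apply: cover_ext => i.
have [y ye] := cover_coord_rep t (shift_idx c (shift_idx d i)).
rewrite (cover_coord_lift _ _ _ _ (cover_coord_lift _ _ _ _ ye)) hK.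
symmetry; apply: cover_coord_le ye.
exact: cidx_le_trans (le_shift_idx _ _) (le_shift_idx _ _).
Qed.

Lemma conj_lifts (A B : finType) (X : shift_space A) (Y : shift_space B)
    (h : homeo X Y) : (forall x : X, h (sigma x) = sigma (h x)) ->
  exists ht : homeo (cover_space X) (cover_space Y),
    (forall t, ht (sigma_cover t) = sigma_cover (ht t)) /\
    (forall t, h (cover_proj t) = cover_proj (ht t)).
Proof.
move=> hs.
have gs y : homeo_inv h (sigma y) = sigma (homeo_inv h y).
  by rewrite -{1}(homeo_invK h y) -hs homeo_funK.
have [c hc] := homeo_code h; have [d gd] := homeo_code (homeo_sym h).
exists (Homeo (cover_liftK (homeo_funK h) (homeo_invK h) hs gs hc gd)
  (cover_liftK (homeo_invK h) (homeo_funK h) gs hs gd hc)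
  (@cover_lift_continuous _ _ _ _ _ _ _ _ _ _ _)
  (@cover_lift_continuous _ _ _ _ _ _ _ _ _ _ _)).
split => t; first exact: cover_lift_sigma.
by symmetry; exact: cover_proj_lift.
Qed.

(** * The topology of the groupoid *)

Section GroupoidTopology.
Variables (A : finType) (X : shift_space A).
Local Notation G := (groupoid X).
Implicit Types (g : G) (s t x y : cover_space X).

Lemma gpd_ext g g' : grange g = grange g' -> gcocycle g = gcocycle g' ->
  gsource g = gsource g' -> g = g'.
Proof.
case: g g' => [x p y e] [x' p' y' e'] /= ex ep ey.
by subst; congr Groupoid; exact: Prop_irrelevance.
Qed.

Lemma open_basic (W : set G) : gpd_basic W -> open W.
Proof.
move=> bW; exists [set W]; last by rewrite bigcup_set1.
by move=> _ ->; exact: (@finI_from1 _ _ (@gpd_basic A X) id W bW).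
Qed.

(** The basic sets are declared only as a subbase, so convergence is tested on
    them one at a time and finite intersections never appear. *)
Lemma gpd_cvg (F : set_system G) g : Filter F ->
  (forall W, gpd_basic W -> W g -> F W) -> F --> g.
Proof.
move=> FF h N [_ [[D' D'sub <-] [W D'W Wg] WN]].
have FW : F W.
  have [E Esub EW] := D'sub _ D'W.
  rewrite -EW; apply: filter_bigI => V VE; apply: h.
    by have := Esub _ VE; rewrite inE.
  by rewrite -EW in Wg; exact: Wg.
apply: filterS FW => g' Wg'; apply: WN; exists W => //.
Qed.

(** These sets exhaust the groupoid. On each of them the topology is induced by
    the product of two copies of the cover: [glevel_nbhs] is one half of this
    claim and [glevel_basis] the other. *)
Definition glevel (i j : nat) : set G :=
  [set g | gcocycle g = i%:Z - j%:Z /\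
    iter i sigma_cover (grange g) = iter j sigma_cover (gsource g)].

Lemma nbhs_cover_agree n t :
  nbhs t [set s | agree n (cover_proj s) (cover_proj t)].
Proof.
exact: (@cover_proj_continuous _ X t _ (@nbhs_agree _ X n (cover_proj t))).
Qed.

Lemma nbhs_iter_inj (n : nat) t (N : set (cover_space X)) : nbhs t N ->
  exists U : set (cover_space X),
    [/\ open U, U t, U `<=` N & set_inj U (iter n sigma_cover)].
Proof.
rewrite nbhsE => -[W [oW Wt] WN].
pose P := [set s : cover_space X |
  agree n (cover_proj s) (cover_proj t)].
exists (W `&` P); split => //.
- apply: openI => //; rewrite openE => s Ps.
  by apply: filterS (nbhs_cover_agree n s) => u /= us m mn; rewrite us// Ps.
- by move=> s [sW _]; exact: WN.
move=> s u /set_mem[_ sP] /set_mem[_ uP]; apply: iter_sigma_cover_inj.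
by move=> m mn; rewrite sP// uP.
Qed.

(** Around an arrow with sigma^i(x) = sigma^j(y), shrink neighbourhoods of x and
    y on which sigma^i and sigma^j are injective to the preimages of the
    intersection O of their images, which is open. Then both images are O, as a
    basic set requires. *)
Lemma glevel_nbhs i j g (N M : set (cover_space X)) : glevel i j g ->
  nbhs (grange g) N -> nbhs (gsource g) M ->
  nbhs g [set g' | [/\ N (grange g'), M (gsource g') & glevel i j g']].
Proof.
move=> [gp ge] /(nbhs_iter_inj i)[U [oU Ug UN injU]]
  /(nbhs_iter_inj j)[V [oV Vg VM injV]].
pose O := iter i sigma_cover @` U `&` iter j sigma_cover @` V.
have oO : open O by apply: openI; exact: iter_sigma_cover_open.
pose U' := U `&` iter i sigma_cover @^-1` O.
pose V' := V `&` iter j sigma_cover @^-1` O.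
have oU' : open U'.
  by apply: openI => //; apply: open_comp => // t _; exact: iter_sigma_cover_continuous.
have oV' : open V'.
  by apply: openI => //; apply: open_comp => // t _; exact: iter_sigma_cover_continuous.
have imU : iter i sigma_cover @` U' = O.
  rewrite eqEsubset; split => [_ [u [_ ?] <-]//|z Oz].
  by have [[u Uu uz] _] := Oz; exists u => //; split => //=; rewrite /preimage/= uz.
have imV : iter j sigma_cover @` V' = O.
  rewrite eqEsubset; split => [_ [u [_ ?] <-]//|z Oz].
  by have [_ [u Uu uz]] := Oz; exists u => //; split => //=; rewrite /preimage/= uz.
pose W : set G := [set g | [/\ U' (grange g), gcocycle g = i%:Z - j%:Z, V' (gsource g) &
        iter i sigma_cover (grange g) = iter j sigma_cover (gsource g)]].
have oW : open W.
  apply: open_basic; exists U', V', i, j; split => //; split => //.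
  - by move=> u v /set_mem[Uu _] /set_mem[Uv _]; apply: injU; exact: mem_set.
  - by move=> u v /set_mem[Uu _] /set_mem[Uv _]; apply: injV; exact: mem_set.
  - by rewrite imU imV.
have Wg : W g.
  have Og : O (iter i sigma_cover (grange g)).
    by split; [exists (grange g)|exists (gsource g)].
  by split => //; split => //; rewrite /preimage /= -?ge.
apply: filterS (open_nbhs_nbhs (conj oW Wg)) => g' [[Ug' _] pg' [Vg' _] eg'].
by split; [exact: UN|exact: VM|].
Qed.

Lemma glevel_ex g : exists i j, glevel i j g.
Proof. by have [i [j h]] := gpd_ex g; exists i, j. Qed.

Lemma grange_continuous : continuous (@grange A X).
Proof.
move=> g N nN; have [i [j gij]] := glevel_ex g.
by apply: filterS (glevel_nbhs gij nN filterT) => g' [].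
Qed.

Lemma gcocycle_locally_constant g :
  nbhs g [set g' | gcocycle g' = gcocycle g].
Proof.
have [i [j gij]] := glevel_ex g.
by apply: filterS (glevel_nbhs gij filterT filterT) => g' [_ _ [e _]] /=;
  rewrite e; case: gij.
Qed.

Lemma glevel_open i j : open (glevel i j).
Proof.
rewrite openE => g gij.
by apply: filterS (glevel_nbhs gij filterT filterT) => g' [].
Qed.

(** An arrow outside has another degree, which is a locally constant function, or
    satisfies sigma^i(x) != sigma^j(y), and then these points have disjoint
    neighbourhoods. *)
Lemma glevel_closed i j : closed (glevel i j).
Proof.
rewrite -[glevel i j]setCK; apply: open_closedC; rewrite openE => g ng.
have [gp|gp] := pselect (gcocycle g = i%:Z - j%:Z); last first.
  by apply: filterS (gcocycle_locally_constant g) => g' /= e [e' _]; apply: gp; rewrite -e.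
have ne : iter i sigma_cover (grange g) != iter j sigma_cover (gsource g).
  by apply/eqP => e; apply: ng.
have := @cover_hausdorff _ X; rewrite open_hausdorff.
move=> /(_ _ _ ne)[[P Q] /= [/set_mem Px /set_mem Qy] [oP oQ /eqP PQ]].
have [k [l gkl]] := glevel_ex g.
have nP : nbhs (grange g) (iter i sigma_cover @^-1` P).
  by apply: iter_sigma_cover_continuous; exact: open_nbhs_nbhs.
have nQ : nbhs (gsource g) (iter j sigma_cover @^-1` Q).
  by apply: iter_sigma_cover_continuous; exact: open_nbhs_nbhs.
apply: filterS (glevel_nbhs gkl nP nQ) => g' [/= Pg' Qg' _] [_ e].
have : (P `&` Q) (iter i sigma_cover (grange g')).
  by split => //; rewrite e.
by move/seteqP: PQ => -[+ _] => /[apply].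
Qed.

Lemma glevel_basis i j g (N : set G) : glevel i j g -> nbhs g N ->
  exists U V : set (cover_space X), [/\ nbhs (grange g) U, nbhs (gsource g) V &
    forall g', glevel i j g' -> U (grange g') -> V (gsource g') -> N g'].
Proof.
move=> gij.
pose D := [set UV : set (cover_space X) * set (cover_space X) |
  nbhs (grange g) UV.1 /\ nbhs (gsource g) UV.2].
pose E (UV : set (cover_space X) * set (cover_space X)) : set G :=
  [set g' | [/\ glevel i j g', UV.1 (grange g') & UV.2 (gsource g')]].
suff : filter_from D E --> g.
  by move=> /[apply] -[[U V] [nU nV] UV]; exists U, V; split => // g' ? ? ?; exact: UV.
have FF : Filter (filter_from D E).
  apply: filter_from_filter; first by exists (setT, setT); split; exact: filterT.
  move=> [U V] [U' V'] [nU nV] [nU' nV'].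
  exists (U `&` U', V `&` V'); first by split; exact: filterI.
  by move=> g' [? [? ?] [? ?]].
apply: gpd_cvg => _ [U [V [k [l [[oU oV injU injV UV] ->]]]]] [Ug gp Vg gkl].
have ijkl : i%:Z - j%:Z = k%:Z - l%:Z by rewrite -gp; case: gij.
have nU : nbhs (grange g) U by exact: open_nbhs_nbhs.
have nV : nbhs (gsource g) V by exact: open_nbhs_nbhs.
have [ik|ki] := leqP i k.
  exists (U, V) => // g' [[p' e'] /= Ug' Vg']; split => //; first by rewrite p' ijkl.
  have -> : k = (k - i + i)%N by rewrite subnK.
  have -> : l = (k - i + j)%N by lia.
  by rewrite !iterD e'.
(* When k < i the last i - k shifts can be undone: near g the letters that they
   delete are fixed, and these letters together with the common tail determine
   the point. *)
pose d := (i - k)%N.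
pose P := [set s : cover_space X |
  agree d (cover_proj (iter k sigma_cover s)) (cover_proj (iter k sigma_cover (grange g)))].
pose Q := [set s : cover_space X |
  agree d (cover_proj (iter l sigma_cover s)) (cover_proj (iter l sigma_cover (gsource g)))].
have nPQ n t : nbhs t [set s : cover_space X |
  agree d (cover_proj (iter n sigma_cover s)) (cover_proj (iter n sigma_cover t))].
  exact: (@iter_sigma_cover_continuous _ X n t _ (nbhs_cover_agree d _)).
exists (U `&` P, V `&` Q).
  by split; apply: filterI => //; exact: nPQ.
move=> g' [[p' e'] /= [Ug' Pg'] [Vg' Qg']]; split => //; first by rewrite p' ijkl.
apply: (@iter_sigma_cover_inj _ X d).
  by move=> m md; rewrite Pg'// gkl Qg'.
rewrite -!iterD.
have -> : (d + k = i)%N by rewrite /d; lia.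
by have -> : (d + l = j)%N by rewrite /d; lia.
Qed.

(** The set of pairs with sigma^i(x) = sigma^j(y) is closed in the product of two
    copies of the cover, hence compact. The proof transfers this with cluster
    points: the range and source maps send a filter on arrows to a filter on
    pairs, a cluster point (x, y) of which satisfies the equation, and
    (x, i - j, y) is a cluster point of the given filter by [glevel_basis]. *)
Lemma glevel_compact i j : compact (glevel i j).
Proof.
have cc : compact [set: cover_space X * cover_space X].
  rewrite -setXTT; apply: compact_setX; exact: cover_space_compact.
move=> F FF Fij.
pose rs (g : G) := (grange g, gsource g).
have [[x y] [_ cl]] := cc (rs @ F) (fmap_proper_filter rs FF) filterT.
have meet (U V : set (cover_space X)) (S : set G) :
    nbhs x U -> nbhs y V -> F S ->
    exists g, [/\ glevel i j g, S g, U (grange g) & V (gsource g)].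
  move=> nU nV FS.
  have nUV : nbhs (x, y) (U `*` V) by exists (U, V).
  have Fim : (rs @ F) (rs @` (S `&` glevel i j)).
    have Fpre : F (rs @^-1` (rs @` (S `&` glevel i j))).
      by apply: filterS (filterI FS Fij) => g Sg; exists g.
    exact: Fpre.
  by have [_ [[g [Sg gij] <-] [/= Ug Vg]]] := cl _ _ Fim nUV; exists g.
have exy : iter i sigma_cover x = iter j sigma_cover y.
  apply: cover_hausdorff => P Q nP nQ.
  have [g [[_ e] _ Pg Qg]] := meet _ _ setT
    (@iter_sigma_cover_continuous _ X i x _ nP)
    (@iter_sigma_cover_continuous _ X j y _ nQ) filterT.
  by exists (iter i sigma_cover (grange g)); split => //; rewrite e.
have gP : exists k l : nat, i%:Z - j%:Z = k%:Z - l%:Z /\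
    iter k sigma_cover x = iter l sigma_cover y by exists i, j.
exists (Groupoid gP); split => //.
move=> S N FS /(@glevel_basis i j)[//|U [V [nU nV UVN]]].
have [g [gij Sg Ug Vg]] := meet U V S nU nV FS.
by exists g; split => //; exact: UVN.
Qed.

End GroupoidTopology.

(** * Conjugacies of covers and isomorphisms of groupoids *)

Section GroupoidMap.
Variables (A B : finType) (X : shift_space A) (Y : shift_space B).
Variable ht : homeo (cover_space X) (cover_space Y).
Hypothesis hts : forall t, ht (sigma_cover t) = sigma_cover (ht t).

Lemma homeo_conj_iter n t :
  ht (iter n sigma_cover t) = iter n sigma_cover (ht t).
Proof. by elim: n => //= n <-. Qed.

Lemma gpd_map_subproof (g : groupoid X) :
  exists i j : nat, gcocycle g = i%:Z - j%:Z /\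
    iter i sigma_cover (ht (grange g)) = iter j sigma_cover (ht (gsource g)).
Proof.
have [i [j [p e]]] := gpd_ex g; exists i, j; split => //.
by rewrite -!homeo_conj_iter e.
Qed.

Definition gpd_map (g : groupoid X) : groupoid Y :=
  Groupoid (gpd_map_subproof g).

Lemma homeo_image_preimage (U : set (cover_space Y)) n :
  iter n sigma_cover @` (ht @^-1` U) = ht @^-1` (iter n sigma_cover @` U).
Proof.
rewrite eqEsubset; split => [_ [t Ut <-]|t [u Uu ut]].
  by exists (ht t) => //; rewrite homeo_conj_iter.
exists (homeo_inv ht u); first by rewrite /preimage /= homeo_invK.
by apply: (can_inj (homeo_funK ht)); rewrite homeo_conj_iter homeo_invK.
Qed.

(** The preimage of a basic set is again basic, being defined by the preimages of
    the same open sets. *)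
Lemma gpd_map_continuous : continuous gpd_map.
Proof.
move=> g; have nf : Filter (nbhs g) := nbhs_filter g.
apply: (@gpd_cvg _ _ _ _ (fmap_filter gpd_map nf)) => W [U [V [i [j [[oU oV injU injV UV] eW]]]]] Wg.
apply: open_nbhs_nbhs; split => //.
have hto (O : set (cover_space Y)) : open O -> open (ht @^-1` O).
  by move=> oO; apply: open_comp => // t _; exact: (@homeo_fun_cts _ _ ht t).
have htinj n (O : set (cover_space Y)) : set_inj O (iter n sigma_cover) ->
    set_inj (ht @^-1` O) (iter n sigma_cover).
  move=> injO s t /set_mem sO /set_mem tO e.
  apply: (can_inj (homeo_funK ht)); apply: injO; try exact: mem_set.
  by rewrite -!homeo_conj_iter e.
apply: open_basic; exists (ht @^-1` U), (ht @^-1` V), i, j; split.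
  by split; try exact: hto; try exact: htinj; rewrite !homeo_image_preimage UV.
rewrite eW eqEsubset; split => g' [/= Ug' pg' Vg' eg']; split => //.
  by apply: (can_inj (homeo_funK ht)); rewrite !homeo_conj_iter.
by rewrite -!homeo_conj_iter eg'.
Qed.

End GroupoidMap.

Section GroupoidIso.
Variables (A B : finType) (X : shift_space A) (Y : shift_space B).

Lemma gpd_mapK (ht : homeo (cover_space X) (cover_space Y)) hts hts' :
  cancel (@gpd_map _ _ X Y ht hts) (@gpd_map _ _ Y X (homeo_sym ht) hts').
Proof. by move=> g; apply: gpd_ext => //=; exact: homeo_funK. Qed.

Lemma gpd_mapK' (ht : homeo (cover_space X) (cover_space Y)) hts hts' :
  cancel (@gpd_map _ _ Y X (homeo_sym ht) hts') (@gpd_map _ _ X Y ht hts).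
Proof. by move=> g; apply: gpd_ext => //=; exact: homeo_invK. Qed.

Lemma homeo_sym_conj (ht : homeo (cover_space X) (cover_space Y)) :
  (forall t, ht (sigma_cover t) = sigma_cover (ht t)) ->
  forall t, homeo_sym ht (sigma_cover t) = sigma_cover (homeo_sym ht t).
Proof. by move=> h t /=; rewrite -{1}(homeo_invK ht t) -h homeo_funK. Qed.

Lemma gpd_map_hom (ht : homeo (cover_space X) (cover_space Y)) hts :
  gpd_hom (@gpd_map _ _ X Y ht hts).
Proof.
move=> g g' c; have c' : composable (gpd_map hts g) (gpd_map hts g').
  by rewrite /composable /= c.
by exists c'; apply: gpd_ext.
Qed.

Lemma gpd_map_eps (ht : homeo (cover_space X) (cover_space Y)) hts g :
  @gpd_map _ _ X Y ht hts (geps g) = geps (gpd_map hts g).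
Proof. by apply: gpd_ext => //=. Qed.

(** The image of a unit is an idempotent arrow, so it has degree 0 and the same
    range and source. *)
Lemma gpd_hom_unit (Psi : groupoid X -> groupoid Y) t :
  gpd_hom Psi -> Psi (gunit t) = gunit (on_units Psi t).
Proof.
move=> hom.
have c : composable (gunit t) (gunit t) by [].
have e : gmul c = gunit t by apply: gpd_ext => //=; rewrite addr0.
have [c' ec] := hom _ _ c; rewrite e in ec.
apply: gpd_ext => //=; have := congr1 (@gcocycle _ _) ec => /= h.
by apply: (addIr (gcocycle (Psi (gunit t)))); rewrite add0r -h.
Qed.

End GroupoidIso.

Section GroupoidConjugacy.
Variables (A B : finType) (X : shift_space A) (Y : shift_space B).
Variable h : homeo X Y.

Lemma conj_gpd_iso (ht : homeo (cover_space X) (cover_space Y)) :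
  (forall t, ht (sigma_cover t) = sigma_cover (ht t)) ->
  (forall t, h (cover_proj t) = cover_proj (ht t)) ->
  exists Psi : homeo (groupoid X) (groupoid Y),
      [/\ gpd_iso Psi,
          forall t, h (cover_proj t) = cover_proj (on_units Psi t),
          forall g, gcocycle g = gcocycle (Psi g) &
          forall g, Psi (geps g) = geps (Psi g)].
Proof.
move=> hts htp; have hts' := homeo_sym_conj hts.
exists (Homeo (gpd_mapK hts hts') (gpd_mapK' hts hts')
  (@gpd_map_continuous _ _ _ _ ht hts) (@gpd_map_continuous _ _ _ _ _ hts')).
split => //.
- by split; exact: gpd_map_hom.
- by move=> g /=; exact: gpd_map_eps.
Qed.

(** A unit at t is sent by [geps] to the unit at the shift of t, so commutation
    with [geps] on units is a conjugacy on the unit spaces. *)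
Lemma gpd_iso_conj (Psi : groupoid X -> groupoid Y) : gpd_hom Psi ->
  (forall t, h (cover_proj t) = cover_proj (on_units Psi t)) ->
  (forall g, Psi (geps g) = geps (Psi g)) ->
  forall x : X, h (sigma x) = sigma (h x).
Proof.
move=> hom hp he x; rewrite -(cover_ofK x); move: (cover_of x) => t {x}.
rewrite -cover_proj_sigma !hp -cover_proj_sigma; congr cover_proj.
have -> : sigma_cover (on_units Psi t) = grange (geps (gunit (on_units Psi t))).
  by [].
rewrite -gpd_hom_unit// -he; congr (grange (Psi _)).
by apply: gpd_ext.
Qed.

End GroupoidConjugacy.

(** * Sums over arbitrary index sets *)

Section UnconditionalSums.
Variables (K : numFieldType) (V : normedModType K).

Lemma sum_single (I : choiceType) (x : I -> V) (i0 : I) :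
  (forall i, i != i0 -> x i = 0) -> summability.sum x = x i0.
Proof.
move=> x0; rewrite /summability.sum; apply: cvg_lim; first exact: norm_hausdorff.
apply: cvg_near_cst; exists [fset i0]%fset => // B /= iB.
have i0B : i0 \in B by apply: (fsubsetP iB); exact: fset11.
rewrite /summability.partial_sum (bigD1 [` i0B]%fset)//= big1 ?addr0// => i.
by move=> ni; apply: x0; apply: contra ni => /eqP e; apply/eqP/val_inj.
Qed.

Lemma sum_zero (I : choiceType) (x : I -> V) :
  (forall i, x i = 0) -> summability.sum x = 0.
Proof.
move=> x0; rewrite /summability.sum; apply: cvg_lim; first exact: norm_hausdorff.
apply: cvg_near_cst; exists fset0 => // B /= _.
by rewrite /summability.partial_sum big1.
Qed.

Lemma partial_sum_reindex (I J : choiceType) (f : I -> J) (x : J -> V)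
    (B : {fset I}) : injective f ->
  summability.partial_sum (x \o f) B = summability.partial_sum x (f @` B)%fset.
Proof.
move=> f_inj; rewrite /summability.partial_sum.
rewrite -(big_seq_fsetE _ _ xpredT x) -(big_seq_fsetE _ _ xpredT (x \o f)) /=.
by rewrite big_imfset//= => i j _ _; exact: f_inj.
Qed.

Lemma sum_filter_reindex (I J : choiceType) (f : I -> J) (g : J -> I)
    (x : J -> V) : cancel f g -> cancel g f ->
  (summability.partial_sum x @ summability.totally) `<=`
  (summability.partial_sum (x \o f) @ summability.totally).
Proof.
move=> fK gK P [E _ EP]; exists (g @` E)%fset => // B /= EB.
rewrite /preimage /= partial_sum_reindex; last exact: can_inj fK.
apply: EP => /=; apply/fsubsetP => j jE.
rewrite -(gK j); apply: in_imfset => /=; apply: (fsubsetP EB).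
exact: in_imfset.
Qed.

(** No summability is assumed: the two nets of partial sums generate the same
    filter, so their limits agree even when they are default values. *)
Lemma sum_reindex (I J : choiceType) (f : I -> J) (g : J -> I)
    (x : J -> V) : cancel f g -> cancel g f ->
  summability.sum (x \o f) = summability.sum x.
Proof.
move=> fK gK; rewrite /summability.sum; congr (lim _).
rewrite eqEsubset; split; last exact: sum_filter_reindex fK gK.
have -> : summability.partial_sum x = summability.partial_sum ((x \o f) \o g).
  by congr summability.partial_sum; apply/funext => j /=; rewrite gK.
exact: sum_filter_reindex gK fK.
Qed.

End UnconditionalSums.

(** * The maps phi and tau, and elements of the algebra *)

Section Convolution.
Variables (R : realType) (A : finType) (X : shift_space A).
Local Notation C := (CC R).
Local Notation G := (groupoid X).
Implicit Types (f g : G -> C) (c : G).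

Lemma gconv_single f g c a b (e : composable a b) : gmul e = c ->
  (forall a' b' (e' : composable a' b'), gmul e' = c ->
     a' = a /\ b' = b \/ f a' * g b' = 0) ->
  gconv f g c = f a * g b.
Proof.
move=> ec h; have abP : (a, b) \in factorizations c by apply/mem_set; exists e.
rewrite /gconv (sum_single (i0 := exist _ (a, b) abP))//.
move=> [[a' b'] ab'] /= ne; have /set_mem [/= e' ec'] := ab'.
have [[ea eb]|//] := h _ _ _ ec'.
by case/eqP: ne; apply: val_inj => /=; rewrite ea eb.
Qed.

Lemma gconv_eq0 f g c : (forall a b (e : composable a b), gmul e = c ->
    f a * g b = 0) -> gconv f g c = 0.
Proof.
move=> h; apply: sum_zero => -[[a b] ab] /=.
by have /set_mem [/= e ec] := ab; exact: (h _ _ e).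
Qed.

(** For c = (x, p, y), these are the products of c with the inverse of the arrow
    (x, 1, sigma x) on the left and with (y, 1, sigma y) on the right. They are
    the cofactors of c that remain in convolutions with s_a and s_a^*. *)
Lemma gshiftl_subproof c : exists i j : nat, gcocycle c - 1 = i%:Z - j%:Z /\
  iter i sigma_cover (sigma_cover (grange c)) = iter j sigma_cover (gsource c).
Proof.
have [i [j [p e]]] := gpd_ex c; exists i, j.+1; split; first by rewrite p; lia.
by rewrite -iterSr /= e.
Qed.
Definition gshiftl c : G := Groupoid (gshiftl_subproof c).

Lemma gshiftr_subproof c : exists i j : nat, gcocycle c + 1 = i%:Z - j%:Z /\
  iter i sigma_cover (grange c) = iter j sigma_cover (sigma_cover (gsource c)).
Proof.
have [i [j [p e]]] := gpd_ex c; exists i.+1, j; split; first by rewrite p; lia.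
by rewrite -iterSr /= e.
Qed.
Definition gshiftr c : G := Groupoid (gshiftr_subproof c).

Lemma gstep_subproof (x : cover_space X) : exists i j : nat,
  1 = i%:Z - j%:Z /\ iter i sigma_cover x = iter j sigma_cover (sigma_cover x).
Proof. by exists 1%N, 0%N. Qed.
Definition gstep x : G := Groupoid (gstep_subproof x).

Definition first_letter (x : cover_space X) : A := letter (cover_proj x) 0%N.

Lemma gen_gstep (a : A) x : gen R a (gstep x) = (first_letter x == a)%:R.
Proof.
rewrite /gen; congr (nat_of_bool _)%:R; apply/asboolP/eqP; first by case.
by move=> <-.
Qed.

Lemma gen_neq0 (a : A) c : gen R a c != 0 -> c = gstep (grange c).
Proof.
rewrite /gen; case: asboolP => [[p s _] _|]; last by rewrite eqxx.
by apply: gpd_ext.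
Qed.

(** Among the factorizations of (x, p, y) only the one through
    (x, 1, sigma x) has its left factor in the support of s_a. *)
Lemma gconv_gen (a : A) f c :
  gconv (gen R a) f c = (first_letter (grange c) == a)%:R * f (gshiftl c).
Proof.
have e : composable (gstep (grange c)) (gshiftl c) by [].
rewrite (gconv_single (e := e)) ?gen_gstep//.
  by apply: gpd_ext => //=; rewrite addrC subrK.
move=> g1 g2 e' ec; have [->|/gen_neq0 g1E] := eqVneq (gen R a g1) 0.
  by right; rewrite mul0r.
left; have g1E' : g1 = gstep (grange c) by rewrite g1E -ec.
split => //; apply: gpd_ext => /=; last by rewrite -ec.
  by rewrite -e' g1E'.
by rewrite -ec /= g1E' /= addrC addKr.
Qed.

Lemma gconv_gen_star (a : A) f c : gconv f (gstar (gen R a)) c =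
  f (gshiftr c) * (first_letter (gsource c) == a)%:R.
Proof.
have e : composable (gshiftr c) (ginv (gstep (gsource c))) by [].
have invK (g : G) : ginv (ginv g) = g by apply: gpd_ext => //=; rewrite opprK.
rewrite (gconv_single (e := e)).
- by rewrite /gstar invK gen_gstep conjC_nat.
- by apply: gpd_ext => //=; rewrite addrK.
move=> g1 g2 e' ec.
have [z|/gen_neq0 gE] := eqVneq (gen R a (ginv g2)) 0.
  by right; rewrite /gstar z conjC0 mulr0.
left; have gE' : g2 = ginv (gstep (gsource c)).
  by rewrite -[g2]invK gE -ec.
split => //; apply: gpd_ext => /=; first by rewrite -ec.
  by rewrite -ec /= gE' /= subrK.
by rewrite e' gE'.
Qed.

Lemma gshiftlr c : gshiftl (gshiftr c) = geps c.
Proof. by apply: gpd_ext => //=; rewrite addrK. Qed.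

Lemma gen_sandwich (a b : A) f c : gconv (gconv (gen R b) f) (gstar (gen R a)) c =
  (first_letter (grange c) == b)%:R * f (geps c) *
  (first_letter (gsource c) == a)%:R.
Proof. by rewrite gconv_gen_star gconv_gen gshiftlr. Qed.

(** At a given arrow only the term s_b f s_a^* with b the first letter of the
    range and a that of the source can be nonzero. *)
Lemma tauE f : tau f = f \o geps.
Proof.
apply/funext => c; rewrite /tau /=.
rewrite (bigD1 (first_letter (gsource c)))//= [X in _ + X]big1 ?addr0; last first.
  move=> a ac; apply: big1 => b _.
  by rewrite gen_sandwich [_ == a]eq_sym (negbTE ac) mulr0.
rewrite (bigD1 (first_letter (grange c)))//= big1 ?addr0; last first.
  by move=> b bc; rewrite gen_sandwich [_ == b]eq_sym (negbTE bc) !mul0r.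
by rewrite gen_sandwich !eqxx mulr1 mul1r.
Qed.

Lemma phiE f c : phi f c =
  (first_letter (grange c) == first_letter (gsource c))%:R * f (geps c).
Proof.
rewrite /phi (bigD1 (first_letter (gsource c)))//= big1 ?addr0; last first.
  move=> a ac.
  by rewrite gen_sandwich [first_letter (gsource c) == a]eq_sym (negbTE ac) mulr0.
by rewrite gen_sandwich eqxx mulr1.
Qed.

Lemma gdiag_unit (d : cover_space X -> C) x : gdiag d (gunit x) = d x.
Proof. by rewrite /gdiag asboolT. Qed.

Lemma gdiag_out (d : cover_space X -> C) c : c <> gunit (grange c) ->
  gdiag d c = 0.
Proof. by move=> h; rewrite /gdiag asboolF. Qed.

(** If epsilon(x, p, y) is a unit, then p = 0 and sigma(x) = sigma(y); as phi
    only sees arrows with x and y having the same first letter, [sigma_cover_inj]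
    gives x = y. Thus phi preserves the diagonal. *)
Lemma phi_gdiag (d : cover_space X -> C) :
  phi (gdiag d) = gdiag (d \o sigma_cover).
Proof.
apply/funext => c; rewrite phiE.
have [cu|cu] := pselect (c = gunit (grange c)).
  rewrite cu eqxx mul1r gdiag_unit.
  have -> : geps (gunit (grange c)) = gunit (sigma_cover (grange c)).
    by apply: gpd_ext.
  by rewrite gdiag_unit.
rewrite (gdiag_out (_ \o _) cu).
have [e|] := eqVneq; last by rewrite mul0r.
rewrite mul1r gdiag_out// => eu; apply: cu; apply: gpd_ext => //=.
  exact: (congr1 (@gcocycle _ _) eu).
symmetry; apply: sigma_cover_inj => //.
by have /= := congr1 (@gsource _ _) eu; move=> ->.
Qed.

Lemma gconv_gdiagl (d : cover_space X -> C) f c :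
  gconv (gdiag d) f c = d (grange c) * f c.
Proof.
have e : composable (gunit (grange c)) c by [].
rewrite (gconv_single (e := e)) ?gdiag_unit//.
  by apply: gpd_ext => //=; rewrite add0r.
move=> g1 g2 e' ec; have [g1u|/(gdiag_out d) g1u] := pselect (g1 = gunit (grange g1)).
  left; have g1E : g1 = gunit (grange c) by rewrite g1u -ec.
  split => //; apply: gpd_ext; rewrite -ec //=.
    by rewrite -e' g1u.
  by rewrite g1u /= add0r.
by right; rewrite g1u mul0r.
Qed.

Lemma phi_incl (u : X -> C) : phi (Defs.incl u) = Defs.incl (u \o sigma).
Proof.
rewrite /Defs.incl phi_gdiag; congr gdiag; apply/funext => t /=.
by rewrite cover_proj_sigma.
Qed.

Lemma incl_unit (u : X -> C) t : Defs.incl u (gunit t) = u (cover_proj t).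
Proof. by rewrite /Defs.incl gdiag_unit. Qed.

(** Although [tau] is not multiplicative, its values on functions of X differ
    from the single element tau(1) by a factor in C(X). *)
Lemma tau_incl_conv (u : X -> C) :
  tau (Defs.incl u) = gconv (Defs.incl (u \o sigma)) (tau (Defs.incl (fun=> 1))).
Proof.
apply/funext => c; rewrite gconv_gdiagl !tauE /= -cover_proj_sigma.
have [cu|cu] := pselect (geps c = gunit (grange (geps c))).
  by rewrite cu !incl_unit mulr1.
by rewrite /Defs.incl !(gdiag_out _ cu) mulr0.
Qed.

(** The diagonal functions are the case i = j = 0 and tau(1) is the case
    i = j = 1, d = 1. *)
Definition glevel_cut (i j : nat) (d : cover_space X -> C) : G -> C :=
  fun c => if `[< glevel i j c >] then d (grange c) else 0.

Lemma glevel_cut_cont_compact i j d : continuous d ->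
  cont_compact_supp (glevel_cut i j d).
Proof.
move=> dc; split.
  move=> c N; rewrite /glevel_cut; case: asboolP => [cl nN|ncl nN].
    have nd : nbhs c [set c' : G | N (d (grange c'))].
      exact: (@grange_continuous _ X c _ (dc _ _ nN)).
    have nl : nbhs c (glevel i j) by apply: open_nbhs_nbhs; split => //; exact: glevel_open.
    by apply: filterS (filterI nd nl) => c' [/= Nc' lc']; rewrite /preimage /= asboolT.
  have nl : nbhs c (~` glevel i j).
    by apply: open_nbhs_nbhs; split => //; apply: closed_openC; exact: glevel_closed.
  apply: filterS nl => c' lc'; rewrite /preimage /= asboolF//.
  exact: nbhs_singleton nN.
apply: (subclosed_compact _ (@glevel_compact _ X i j)); first exact: closed_closure.
rewrite [X in _ `<=` X](closure_id _).1; last exact: glevel_closed.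
apply: closureS => c /=; rewrite /glevel_cut; case: asboolP => //.
by rewrite eqxx.
Qed.

Lemma l2norm0 : l2norm (fun _ : G => 0 : C) = 0%E.
Proof.
rewrite /l2norm esum1 ?poweR0r ?invr_eq0 ?pnatr_eq0// => c _.
by rewrite /cabs normr0 expr0n.
Qed.

(** Such a function is its own approximation; what remains is that the reduced
    norm of 0 is 0. *)
Lemma cont_compact_supp_OX f : cont_compact_supp f -> OX R X f.
Proof.
move=> ff e e0; exists f => //.
apply: (@Order.POrderTheory.le_lt_trans _ _ 0%E); last by rewrite lte_fin.
apply: ub_ereal_sup => _ [xi _ <-].
rewrite (_ : gconv _ _ = (fun=> 0)) ?l2norm0//.
apply/funext => c; apply: gconv_eq0 => a b _ _.
by rewrite /= subrr mul0r.
Qed.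

Lemma glevel_cut_OX i j d : continuous d -> OX R X (glevel_cut i j d).
Proof. by move=> /(@glevel_cut_cont_compact i j) /cont_compact_supp_OX. Qed.

Lemma gdiag_glevel_cut (d : cover_space X -> C) : gdiag d = glevel_cut 0 0 d.
Proof.
apply/funext => c; rewrite /gdiag /glevel_cut; congr (if _ then _ else _).
apply/asboolP/asboolP => [cu|[p e]]; last by apply: gpd_ext.
by split; rewrite cu.
Qed.

Lemma gdiag_OX (d : cover_space X -> C) : continuous d -> OX R X (gdiag d).
Proof. by rewrite gdiag_glevel_cut; exact: glevel_cut_OX. Qed.

Lemma continuous_comp_proj (u : X -> C) : continuous u ->
  continuous (u \o cover_proj).
Proof.
move=> uc t; apply: continuous_comp; [exact: cover_proj_continuous|exact: uc].
Qed.

Lemma incl_OX (u : X -> C) : continuous u -> OX R X (Defs.incl u).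
Proof. by move=> uc; apply: gdiag_OX; exact: continuous_comp_proj. Qed.

Lemma tau_unit_OX : OX R X (tau (Defs.incl (fun=> 1))).
Proof.
rewrite (_ : tau _ = glevel_cut 1 1 (fun=> 1)).
  by apply: glevel_cut_OX; exact: cst_continuous.
apply/funext => c; rewrite tauE /= /Defs.incl /gdiag /glevel_cut.
congr (if _ then _ else _).
apply/asboolP/asboolP => [cu|[p e]]; last by apply: gpd_ext.
by split; [exact: (congr1 (@gcocycle _ _) cu)|
  have /= -> := congr1 (@gsource _ _) cu].
Qed.

End Convolution.

(** * Transport of functions along a conjugacy of covers *)

Section Pullback.
Variables (R : realType) (A B : finType) (X : shift_space A) (Y : shift_space B).
Variable ht : homeo (cover_space X) (cover_space Y).
Hypothesis hts : forall t, ht (sigma_cover t) = sigma_cover (ht t).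
Local Notation C := (CC R).
Local Notation ht' := (homeo_sym ht).
Local Notation hts' := (homeo_sym_conj hts).
Local Notation phiXY := (gpd_map hts).
Local Notation phiYX := (gpd_map hts').
Implicit Types (f g : groupoid Y -> C).

Lemma fact_map (c : groupoid X) (ab : groupoid X * groupoid X) :
  ab \in factorizations c ->
  (phiXY ab.1, phiXY ab.2) \in factorizations (phiXY c).
Proof.
move=> /set_mem[e ec]; apply/mem_set => /=.
by have [e' ee] := gpd_map_hom hts e; exists e'; rewrite -ee ec.
Qed.

Lemma fact_map_inv (c : groupoid X) (ab : groupoid Y * groupoid Y) :
  ab \in factorizations (phiXY c) ->
  (phiYX ab.1, phiYX ab.2) \in factorizations c.
Proof.
move=> /set_mem[e ec]; apply/mem_set => /=.
have [e' ee] := gpd_map_hom hts' e; exists e'; rewrite -ee ec.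
exact: gpd_mapK.
Qed.

Lemma gconv_pull f g : gconv (f \o phiXY) (g \o phiXY) = gconv f g \o phiXY.
Proof.
apply/funext => c; rewrite /gconv /=.
pose F (ab : factorizations c) : factorizations (phiXY c) :=
  exist (fun z => z \in factorizations (phiXY c)) _ (fact_map (valP ab)).
pose F' (ab : factorizations (phiXY c)) : factorizations c :=
  exist (fun z => z \in factorizations c) _ (fact_map_inv (valP ab)).
rewrite -(@sum_reindex _ _ _ _ F F')//.
  by move=> [[a b] ab]; apply: val_inj; rewrite /= !gpd_mapK.
by move=> [[a b] ab]; apply: val_inj; rewrite /= !gpd_mapK'.
Qed.

Lemma gstar_pull f : gstar (f \o phiXY) = gstar f \o phiXY.
Proof.
by apply/funext => c; rewrite /gstar /=; congr ((f _)^*); apply: gpd_ext.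
Qed.

Lemma l2norm_pull f : l2norm (f \o phiXY) = l2norm f.
Proof.
rewrite /l2norm; congr (_ `^ _)%E.
rewrite (@reindex_esum _ _ _ [set: groupoid X] [set: groupoid Y] phiXY)//.
rewrite setTT_bijective; exists phiYX; [exact: gpd_mapK|exact: gpd_mapK'].
Qed.

Lemma fin_supp_over_pull t f : fin_supp_over t f ->
  fin_supp_over (ht' t) (f \o phiXY).
Proof.
move=> [ff fs]; split; last first.
  by move=> c /= /fs <-; rewrite /= homeo_funK.
apply: (@finite_preimage _ _ [set c | f c != 0] phiXY) => // a b _ _.
exact: (can_inj (gpd_mapK hts hts')).
Qed.

(** Composition with the groupoid isomorphism is an isometry of the spaces of
    square summable functions that intertwines the convolution operators and
    preserves the vectors tested in the definition of the norm. *)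
Lemma reduced_norm_pull_le f :
  (reduced_norm f <= reduced_norm (f \o phiXY))%E.
Proof.
apply: ereal_sup_le => _ [xi [[t xit] xi1] <-].
exists (xi \o phiXY); last by rewrite gconv_pull l2norm_pull.
split; last by rewrite /= l2norm_pull.
by exists (ht' t); exact: fin_supp_over_pull.
Qed.

Lemma cont_compact_supp_pull f : cont_compact_supp f ->
  cont_compact_supp (f \o phiXY).
Proof.
move=> [fc fs]; split.
  by move=> c; apply: continuous_comp; [exact: gpd_map_continuous|exact: fc].
pose K := phiYX @` closure [set c | f c != 0].
have cK : compact K.
  apply: continuous_compact => //.
  exact/continuous_subspaceT/gpd_map_continuous.
have KE : K = phiXY @^-1` closure [set c | f c != 0].
  rewrite eqEsubset; split => [_ [c fc' <-]|c cc]; first by rewrite /preimage/= gpd_mapK'.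
  by exists (phiXY c) => //; exact: gpd_mapK.
have clK : closed K.
  rewrite KE; apply: closed_comp; last exact: closed_closure.
  move=> c _; exact: gpd_map_continuous.
apply: (subclosed_compact _ cK); first exact: closed_closure.
rewrite [X in _ `<=` X](closure_id _).1//; apply: closureS => c fc'.
by rewrite KE; apply: subset_closure.
Qed.

End Pullback.

Section PullbackAlgebra.
Variables (R : realType) (A B : finType) (X : shift_space A) (Y : shift_space B).
Variable ht : homeo (cover_space X) (cover_space Y).
Hypothesis hts : forall t, ht (sigma_cover t) = sigma_cover (ht t).
Local Notation C := (CC R).
Local Notation phiXY := (gpd_map hts).
Implicit Types (f g : groupoid Y -> C).

Lemma reduced_norm_pull f : reduced_norm (f \o phiXY) = reduced_norm f.
Proof.
have E : (f \o phiXY) \o gpd_map (homeo_sym_conj hts) = f.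
  by apply/funext => c; rewrite /= gpd_mapK'.
have le1 := reduced_norm_pull_le (homeo_sym_conj hts) (f \o phiXY).
rewrite E in le1.
by apply/le_anti/andP; split; [exact: le1|exact: reduced_norm_pull_le].
Qed.

Lemma OX_pull f : OX R Y f -> OX R X (f \o phiXY).
Proof.
move=> fO e /fO[g gc ge]; exists (g \o phiXY); first exact: cont_compact_supp_pull.
have -> : (f \o phiXY) \- (g \o phiXY) = (f \- g) \o phiXY by [].
by rewrite reduced_norm_pull.
Qed.

Lemma gdiag_pull (d : cover_space Y -> C) :
  gdiag d \o phiXY = gdiag (d \o ht).
Proof.
apply/funext => c; rewrite /gdiag /=; congr (if _ then _ else _).
apply/asboolP/asboolP => [e|->]; last by apply: gpd_ext.
apply: gpd_ext => //=; first exact: (congr1 (@gcocycle _ _) e).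
by apply: (can_inj (homeo_funK ht)); exact: (congr1 (@gsource _ _) e).
Qed.

Lemma continuous_comp_homeo (d : cover_space Y -> C) :
  continuous d -> continuous (d \o ht).
Proof.
by move=> dc t; apply: continuous_comp; [exact: homeo_fun_cts|exact: dc].
Qed.

Lemma DX_pull f : DX R Y f -> DX R X (f \o phiXY).
Proof.
move=> [d dc <-]; exists (d \o ht); first exact: continuous_comp_homeo.
by rewrite gdiag_pull.
Qed.

Lemma tau_pull f : tau (f \o phiXY) = tau f \o phiXY.
Proof.
by rewrite !tauE; apply/funext => c /=; rewrite gpd_map_eps.
Qed.

Lemma phi_pull f : DX R Y f -> phi (f \o phiXY) = phi f \o phiXY.
Proof.
move=> [d dc <-]; rewrite gdiag_pull !phi_gdiag gdiag_pull.
by congr gdiag; apply/funext => t /=; rewrite hts.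
Qed.

Lemma cond_exp_pull f : cond_exp (f \o phiXY) = cond_exp f \o phiXY.
Proof.
rewrite /cond_exp gdiag_pull; congr gdiag; apply/funext => t /=.
by congr f; apply: gpd_ext.
Qed.

Lemma incl_pull (h : X -> Y) (u : Y -> C) :
  (forall t, h (cover_proj t) = cover_proj (ht t)) ->
  Defs.incl u \o phiXY = Defs.incl (u \o h).
Proof.
move=> hp; rewrite /Defs.incl gdiag_pull; congr gdiag.
by apply/funext => t /=; rewrite hp.
Qed.

End PullbackAlgebra.

Section Push.
Variables (R : realType) (A B : finType) (X : shift_space A) (Y : shift_space B).
Variable ht : homeo (cover_space X) (cover_space Y).
Hypothesis hts : forall t, ht (sigma_cover t) = sigma_cover (ht t).
Local Notation C := (CC R).
Local Notation hts' := (homeo_sym_conj hts).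

Definition push (f : groupoid X -> C) : groupoid Y -> C :=
  f \o gpd_map hts'.

Lemma push_star_iso (S : set (groupoid X -> C)) (T : set (groupoid Y -> C)) :
  (forall f, S f -> T (push f)) -> (forall f, T f -> S (f \o gpd_map hts)) ->
  star_iso S T push.
Proof.
move=> ST TS; split.
- split.
  + by move=> f /ST.
  + move=> f g _ _ e; apply/funext => c.
    have := congr1 (fun F => F (gpd_map hts c)) e.
    by rewrite /push /= !gpd_mapK.
  + move=> f Tf; exists (f \o gpd_map hts); first exact: TS.
    by apply/funext => c /=; rewrite /push /= gpd_mapK'.
- by [].
- by move=> f g _ _; rewrite /push gconv_pull.
- by move=> f _; rewrite /push gstar_pull.
Qed.

Lemma push_restricts (h : homeo X Y) :
  (forall t, h (cover_proj t) = cover_proj (ht t)) -> restricts_to h push.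
Proof.
move=> hp; have hp' t : homeo_inv h (cover_proj t) = cover_proj (homeo_inv ht t).
  by rewrite -{1}(homeo_invK ht t) -hp homeo_funK.
have pu (u : X -> C) : push (Defs.incl u) = Defs.incl (u \o homeo_inv h).
  exact: incl_pull.
split; last by move=> u _.
rewrite eqEsubset; split => [_ [_ [u uc <-] <-]|_ [u uc <-]].
  rewrite pu; exists (u \o homeo_inv h) => // y.
  by apply: continuous_comp; [exact: homeo_inv_cts|exact: uc].
exists (Defs.incl (u \o h)).
  exists (u \o h) => // y.
  by apply: continuous_comp; [exact: homeo_fun_cts|exact: uc].
rewrite pu; congr Defs.incl; apply/funext => y /=.
by rewrite homeo_invK.
Qed.

End Push.

(** * Recovering the conjugacy *)

Section Separation.
Variables (R : realType) (A : finType) (X : shift_space A).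
Local Notation C := (CC R).

Lemma letter_fun_continuous n (a : A) :
  continuous (fun x : X => (letter x n == a)%:R : C).
Proof.
move=> x N nN.
by apply: filterS (nbhs_letter n x) => y /= e; rewrite /preimage /= e; exact: nbhs_singleton nN.
Qed.

(** The indicators of the letters at each position already separate points. *)
Lemma continuous_separates (x y : X) :
  (forall u : X -> C, continuous u -> u x = u y) -> x = y.
Proof.
move=> h; apply: letter_ext => n.
have := h _ (@letter_fun_continuous n (letter y n)).
by rewrite eqxx; case: eqP => // _ /eqP; rewrite eq_sym oner_eq0.
Qed.

End Separation.

Section Converse.
Variables (R : realType) (A B : finType) (X : shift_space A) (Y : shift_space B).
Variable h : homeo X Y.
Local Notation C := (CC R).

Lemma sigma_continuous : continuous (@sigma A X).
Proof.
by apply: continuous_letterwise => x n; exact: nbhs_letter.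
Qed.

Lemma conj_of_inv_functions :
  (forall u : X -> C, continuous u -> forall t : cover_space Y,
    u (sigma (homeo_inv h (cover_proj t))) =
    u (homeo_inv h (sigma (cover_proj t)))) ->
  forall x : X, h (sigma x) = sigma (h x).
Proof.
move=> hu x; apply: (can_inj (homeo_invK h)); rewrite homeo_funK.
apply: (@continuous_separates R) => u uc.
have := hu u uc (cover_of (h x)); rewrite cover_ofK => <-.
by rewrite homeo_funK.
Qed.

(** Apply Phi to tau(u) = (u o sigma) * tau(1). As Phi is multiplicative and
    commutes with [tau], and Phi(1) = 1, evaluation of both sides at the unit at
    t compares u o h^-1 o sigma with u o sigma o h^-1. *)
Lemma tau_iso_conj (Phi : (groupoid X -> C) -> groupoid Y -> C) :
  star_iso (OX R X) (OX R Y) Phi -> restricts_to h Phi ->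
  (forall f, OX R X f -> Phi (tau f) = tau (Phi f)) ->
  forall x : X, h (sigma x) = sigma (h x).
Proof.
move=> [_ _ Pconv _] [_ Pu] Ptau; apply: conj_of_inv_functions => u uc t.
have c1 : continuous ((fun=> 1) : X -> C) by exact: cst_continuous.
have usc : continuous (u \o sigma).
  by move=> x; apply: continuous_comp; [exact: sigma_continuous|exact: uc].
have := Ptau _ (incl_OX uc).
rewrite tau_incl_conv Pconv; [|exact: incl_OX|exact: tau_unit_OX].
rewrite Ptau; last exact: incl_OX.
rewrite !Pu// => /(congr1 (fun F => F (gunit t))).
rewrite gconv_gdiagl !tauE /=.
have -> : geps (gunit t) = gunit (sigma_cover t) by apply: gpd_ext.
by rewrite !incl_unit /= mulr1 cover_proj_sigma.
Qed.

Lemma phi_iso_conj (Omega : (groupoid X -> C) -> groupoid Y -> C) :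
  restricts_to h Omega ->
  (forall d, DX R X d -> Omega (phi d) = phi (Omega d)) ->
  forall x : X, h (sigma x) = sigma (h x).
Proof.
move=> [_ Pu] Pphi; apply: conj_of_inv_functions => u uc t.
have usc : continuous (u \o sigma).
  by move=> x; apply: continuous_comp; [exact: sigma_continuous|exact: uc].
have Du : DX R X (Defs.incl u).
  by exists (u \o cover_proj) => //; exact: continuous_comp_proj.
have := Pphi _ Du; rewrite phi_incl !Pu// phi_incl.
by move=> /(congr1 (fun F => F (gunit t))); rewrite !incl_unit.
Qed.

End Converse.

Theorem theorem4p4 (R : realType) (A B : finType)
    (X : shift_space A) (Y : shift_space B) (h : homeo X Y) :
  [<->
    (* i *)
    (forall x : X, h (sigma x) = sigma (h x));
    (* ii *)
    (exists ht : homeo (cover_space X) (cover_space Y),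
      (forall t, ht (sigma_cover t) = sigma_cover (ht t)) /\
      (forall t, h (cover_proj t) = cover_proj (ht t)));
    (* iii *)
    (exists Psi : homeo (groupoid X) (groupoid Y),
      [/\ gpd_iso Psi,
          forall t, h (cover_proj t) = cover_proj (on_units Psi t),
          forall g, gcocycle g = gcocycle (Psi g) &
          forall g, Psi (geps g) = geps (Psi g)]);
    (* iv *)
    (exists Psi : homeo (groupoid X) (groupoid Y),
      [/\ gpd_iso Psi,
          forall t, h (cover_proj t) = cover_proj (on_units Psi t) &
          forall g, Psi (geps g) = geps (Psi g)]);
    (* v *)
    (exists Phi : (groupoid X -> CC R) -> groupoid Y -> CC R,
      [/\ star_iso (OX R X) (OX R Y) Phi,
          restricts_to h Phi,
          (forall f, OX R X f -> Phi (cond_exp f) = cond_exp (Phi f)),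
          (forall z : CC R, `|z| = 1 ->
            forall f, OX R X f -> Phi (gauge z f) = gauge z (Phi f)) &
          (forall d, DX R X d -> Phi (phi d) = phi (Phi d)) /\
          (forall f, OX R X f -> Phi (tau f) = tau (Phi f))]);
    (* vi *)
    (exists Phi : (groupoid X -> CC R) -> groupoid Y -> CC R,
      [/\ star_iso (OX R X) (OX R Y) Phi,
          restricts_to h Phi &
          forall f, OX R X f -> Phi (tau f) = tau (Phi f)]);
    (* vii *)
    (exists Omega : (groupoid X -> CC R) -> groupoid Y -> CC R,
      [/\ star_iso (DX R X) (DX R Y) Omega,
          restricts_to h Omega &
          forall d, DX R X d -> Omega (phi d) = phi (Omega d)])
  ].
Proof.
do !apply: AllIffConj.
- exact: conj_lifts.
- by move=> [ht [hts htp]]; exact: conj_gpd_iso hts htp.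
- by move=> [Psi [? ? ? ?]]; exists Psi; split.
(* (iv) need not preserve the degree, so Phi is not built from the given Psi: (iv)
   yields the conjugacy (i), and this yields a new, degree-preserving isomorphism. *)
- move=> [Psi [[hom _] hp he]].
  have [ht [hts htp]] := conj_lifts (gpd_iso_conj hom hp he).
  exists (push hts); split.
  + by apply: push_star_iso => f; exact: OX_pull.
  + exact: push_restricts.
  + by move=> f _; rewrite /push cond_exp_pull.
  + by [].
  + by split => f Sf; rewrite /push ?phi_pull// tau_pull.
- by move=> [Phi [? ? _ _ [_ ?]]]; exists Phi; split.
(* Phi is not known to map the diagonal to the diagonal, so Omega is again built
   from the conjugacy (i) and not by restricting Phi. *)
- move=> [Phi [iso res ct]].
  have [ht [hts htp]] := conj_lifts (tau_iso_conj iso res ct).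
  exists (push hts); split; last by move=> d Dd; rewrite /push phi_pull.
  + by apply: push_star_iso => f; exact: DX_pull.
  + exact: push_restricts.
- by move=> [W [_ res cp]]; exact: phi_iso_conj res cp.
Qed.
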